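(* Let $(B,+,\circ)$ be a non-trivial skew brace. If $(B,\circ)$ is torsion-free and locally cyclic, then $(B,+)=(C,+)\rtimes\langle a\rangle_+$, where $C$ is a trivial sub-skew brace with $(C,+)\simeq(B,\circ)$, and $a$ is an element of order $2$ of $(B,+)$ inverting $(C,+)$. Moreover, $B$ is not Dedekind, $(C,+)$ is not $2$-divisible, and either (1) $\operatorname{Ker}(\lambda)=C$, $\lambda_a(b)=-b$ for every $b\in C$, and $\lambda_a(a)=a+a\circ a$, or (2) $\operatorname{Ker}(\lambda)=B\ast C=\{0\}$, so in particular $a\circ b=a+b$ for every $b\in C$. Conversely, let $(X,\circ)$ be any subgroup of the group of rational numbers under addition (with its operation written $\circ$ and identity written $0$) which is not $2$-divisible, let $X^2=\{y\circ y: y\in X\}$, and choose $x\in X\setminus\{0\}$ with no square root in $X$ (that is, $x\notin X^2$). (1) Define a new operation $+$ on $X$ as follows: $x+x=0$, $b+d=b\circ d$, $x-d=x\circ d$, and $x+d+x=d^{-1}=-d$ for every $b,d\in X^2$. Then $(X,+,\circ)$ is a skew brace with $\operatorname{Ker}(\lambda)=X^2$. (2) Define a new operation $+$ on $X$ as follows: $x+x=0$, $b+d=b\circ d$, $x+d=x\circ d$, and $x+d+x=d^{-1}=-d$ for every $b,d\in X^2$. Then $(X,+,\circ)$ is a skew brace with $\operatorname{Ker}(\lambda)=\{0\}$. (The two skew braces in (1) and (2) of the converse are opposite to each other.)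
   Context: A skew brace is a triple $(B,+,\circ)$ with $(B,+)$, $(B,\circ)$ (not necessarily abelian) groups such that $a\circ(b+c)=a\circ b-a+a\circ c$ for all $a,b,c\in B$. The identities of the two groups coincide and are denoted by $0$; $-b$ and $b^{-1}$ denote inverses in $(B,+)$ and $(B,\circ)$ respectively. For $a\in B$ put $\lambda_a(b)=-a+a\circ b$; then $\lambda:a\mapsto\lambda_a$ is a homomorphism $(B,\circ)\to\operatorname{Aut}(B,+)$ with kernel $\operatorname{Ker}(\lambda)$. Put $a\ast b=-a+a\circ b-b$, and for $X,Y\subseteq B$ let $X\ast Y$ be the subgroup of $(B,+)$ generated by all $x\ast y$, $x\in X$, $y\in Y$. $B$ is trivial if $a+b=a\circ b$ for all $a,b\in B$. A sub-skew brace is a subset that is a subgroup of both $(B,+)$ and $(B,\circ)$. An ideal is a subgroup of $(B,+)$ that is normal in $(B,+)$, invariant under all $\lambda_b$, and normal in $(B,\circ)$. $B$ is Dedekind if all its sub-skew braces are ideals of $B$. $\langle a\rangle_+$ is the subgroup of $(B,+)$ generated by $a$. The opposite of a skew brace $(B,+,\circ)$ is the skew brace $(B,+^{\operatorname{opp}},\circ)$ with $a+^{\operatorname{opp}}b=b+a$. A group is locally cyclic if every finitely generated subgroup is cyclic. An abelian group is $2$-divisible if each of its elements is the double (square, in multiplicative notation) of some element. In the converse, $X^2$ has index $2$ in $(X,\circ)$, so $X=X^2\cup (x\circ X^2)$ and the listed rules describe the group operation $+$ on all of $X$. *)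

(* Defs.v *)
From mathcomp Require Import all_boot all_order all_algebra.
From mathcomp Require Import mathcomp_extra boolp classical_sets functions cardinality.

Set Implicit Arguments.
Unset Strict Implicit.
Unset Printing Implicit Defensive.

Local Open Scope classical_set_scope.

(* Groups are records over a bare carrier rather than [groupType] instances,
   because a skew brace puts two unrelated group structures on one type. *)
Record group (T : Type) := Group {
  gop : T -> T -> T;
  gid : T;
  ginv : T -> T;
  gopA : associative gop;
  gop1x : left_id gid gop;
  gopx1 : right_id gid gop;
  gopVx : left_inverse gid ginv gop;
  gopxV : right_inverse gid ginv gop }.

Section Groups.
Variables (T : Type) (G : group T).

Definition gpow (x : T) (n : nat) : T := iter n (gop G x) (gid G).

Definition has_order (x : T) (n : nat) : Prop :=
  [/\ (0 < n)%N, gpow x n = gid G &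
      forall m, (0 < m < n)%N -> gpow x m <> gid G].

Definition torsion_free : Prop :=
  forall (x : T) (n : nat), (0 < n)%N -> gpow x n = gid G -> x = gid G.

Definition subgroup (S : set T) : Prop :=
  [/\ S (gid G), forall x y, S x -> S y -> S (gop G x y) &
      forall x, S x -> S (ginv G x)].

Definition generated (S : set T) : set T := smallest subgroup S.

Definition locally_cyclic : Prop :=
  forall S : set T, finite_set S ->
    exists g : T, generated S = generated [set g].

Definition normal (N : set T) : Prop :=
  subgroup N /\
  forall g x, N x -> N (gop G (gop G g x) (ginv G g)).

(* internal semidirect product: the whole group is N ><| H *)
Definition semidirect (N H : set T) : Prop :=
  [/\ normal N, subgroup H, N `&` H = [set gid G] &
      forall g, exists n h, [/\ N n, H h & g = gop G n h]].

Definition squares : set T := [set z | exists y, z = gop G y y].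

Definition two_divisible : Prop := forall z, squares z.

End Groups.

Definition isomorphic (T U : Type) (G : group T) (H : group U) : Prop :=
  exists f : T -> U, bijective f /\ {morph f : x y / gop G x y >-> gop H x y}.

Section SubGroup.
Variables (T : Type) (G : group T) (S : set T) (hS : subgroup G S).

Let mem1 : gid G \in S. Proof. by rewrite in_setE; case: hS. Qed.
Let memM (x y : S) : gop G (val x) (val y) \in S.
Proof.
by have [_ h _] := hS; rewrite in_setE; apply: h; rewrite -in_setE; apply: valP.
Qed.
Let memV (x : S) : ginv G (val x) \in S.
Proof.
by have [_ _ h] := hS; rewrite in_setE; apply: h; rewrite -in_setE; apply: valP.
Qed.

Let op (x y : S) : S := Sub (gop G (val x) (val y)) (memM x y).
Let one : S := Sub (gid G) mem1.
Let inv (x : S) : S := Sub (ginv G (val x)) (memV x).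

Let opA : associative op.
Proof. by move=> x y z; apply: val_inj; rewrite /= gopA. Qed.
Let op1x : left_id one op.
Proof. by move=> x; apply: val_inj; rewrite /= gop1x. Qed.
Let opx1 : right_id one op.
Proof. by move=> x; apply: val_inj; rewrite /= gopx1. Qed.
Let opVx : left_inverse one inv op.
Proof. by move=> x; apply: val_inj; rewrite /= gopVx. Qed.
Let opxV : right_inverse one inv op.
Proof. by move=> x; apply: val_inj; rewrite /= gopxV. Qed.

Definition subg : group S := Group opA op1x opx1 opVx opxV.

End SubGroup.

Definition oppg (T : Type) (G : group T) : group T :=
  @Group T (fun x y => gop G y x) (gid G) (ginv G)
    (fun x y z => esym (gopA G z y x)) (gopx1 G) (gop1x G) (gopxV G) (gopVx G).

Definition rat_group : group rat :=
  @Group rat (@GRing.add rat) 0%R (@GRing.opp rat)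
    (@GRing.addrA _) (@GRing.add0r _) (@GRing.addr0 _)
    (@GRing.addNr _) (@GRing.addrN _).

(* a o (b + c) = a o b - a + a o c *)
Definition brace_law (T : Type) (A M : group T) : Prop :=
  forall a b c,
    gop M a (gop A b c) =
    gop A (gop A (gop M a b) (ginv A a)) (gop M a c).

Record skewBrace (T : Type) := SkewBrace {
  addg : group T;
  mulg : group T;
  braceP : brace_law addg mulg }.

Notation "x +[ B ] y" := (gop (addg B) x y)
  (at level 50, B at level 200, left associativity, format "x  +[ B ]  y").
Notation "x o[ B ] y" := (gop (mulg B) x y)
  (at level 40, B at level 200, left associativity, format "x  o[ B ]  y").
Notation "-[ B ] x" := (ginv (addg B) x)
  (at level 35, B at level 200, x at level 35, right associativity,
   format "-[ B ]  x").
Notation "0[ B ]" := (gid (addg B)) (at level 0, B at level 200, format "0[ B ]").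

Section SkewBraces.
Variables (T : Type) (B : skewBrace T).

Definition lambda (a b : T) : T := -[B] a +[B] (a o[B] b).

Definition ker_lambda : set T := [set a | forall b, lambda a b = b].

Definition star (a b : T) : T := -[B] a +[B] (a o[B] b) +[B] -[B] b.

Definition star_set (X Y : set T) : set T :=
  generated (addg B) [set z | exists x y, [/\ X x, Y y & z = star x y]].

Definition trivial_brace : Prop := forall a b, a +[B] b = a o[B] b.

Definition sub_skew_brace (S : set T) : Prop :=
  subgroup (addg B) S /\ subgroup (mulg B) S.

Definition ideal (I : set T) : Prop :=
  [/\ normal (addg B) I,
      forall b x, I x -> I (lambda b x) &
      normal (mulg B) I].

Definition dedekind : Prop :=
  forall S : set T, sub_skew_brace S -> ideal S.

Lemma oppg_brace_law : brace_law (oppg (addg B)) (mulg B).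
Proof. by move=> a b c; rewrite /= (braceP B) gopA. Qed.

Definition opp_brace : skewBrace T := SkewBrace oppg_brace_law.

End SkewBraces.

Section SubBrace.
Variables (T : Type) (B : skewBrace T) (S : set T) (hS : sub_skew_brace B S).

Lemma sub_brace_law : brace_law (subg (proj1 hS)) (subg (proj2 hS)).
Proof. by move=> a b c; apply: val_inj; rewrite /= (braceP B). Qed.

Definition sub_brace : skewBrace S := SkewBrace sub_brace_law.

End SubBrace.

(* [M] is the given group (X, o), [A] a candidate for (X, +); the two sets of
   rules differ only in [x - d = x o d] versus [x + d = x o d]. *)
Section Rules.
Variables (T : Type) (M : group T) (x : T) (A : group T).

Definition rules1 : Prop :=
  [/\ gop A x x = gid M,
      forall b d, squares M b -> squares M d -> gop A b d = gop M b d,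
      forall d, squares M d -> gop A x (ginv A d) = gop M x d &
      forall d, squares M d ->
        gop A (gop A x d) x = ginv M d /\ ginv M d = ginv A d].

Definition rules2 : Prop :=
  [/\ gop A x x = gid M,
      forall b d, squares M b -> squares M d -> gop A b d = gop M b d,
      forall d, squares M d -> gop A x d = gop M x d &
      forall d, squares M d ->
        gop A (gop A x d) x = ginv M d /\ ginv M d = ginv A d].

End Rules.

(* Main.v *)
From HB Require Import structures.
Require Import Defs.
From mathcomp Require Import all_boot all_order all_algebra.
From mathcomp Require Import mathcomp_extra boolp classical_sets functions cardinality.
From mathcomp Require Import ring zify.

(** A locally cyclic torsion-free group has rank one: any two elements are
    powers of a common element, so any two non-trivial elements have a common
    non-trivial power.  The structure theorem plays this against the ideal
    I = B * B, which is non-zero because B is non-trivial.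

    The group (B, o) is abelian, so the group of the maps x |-> b + lambda_a(x)
    is the product of two abelian subgroups, the lambda_a and the translations
    x |-> a o x of (B, o).  Ito's theorem makes its commutator subgroup abelian,
    and this commutator subgroup consists of translations by elements of I: hence
    (I, +) is abelian ([star_commute]).  Now I is a commutative radical ring
    under + and star whose adjoint group (I, o) is torsion-free of rank one.
    Such a ring has zero multiplication ([radical_mul0]), so I is a trivial
    brace.  The ring argument starts from a multiplicative relation between
    1 + x and 1 + x + x^2: it is a polynomial equation for x with integer
    coefficients and value -1 at -1.  Reduced modulo p it excludes additive
    p-torsion; over the rationals it makes x nilpotent, since otherwise some
    v <> 0 satisfies v^2 = N v, and then the integers 1 + N and 1 + 2 N would be
    multiplicatively dependent; in a nil ring of this kind all squares vanish.

    Write lambda^op_b(x) = b + lambda_b(x) - b for the lambda map of the opposite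
    brace.  Both lambda_b and lambda^op_b restrict to I as automorphisms of finite
    order, since a power of b lies in I; an automorphism of finite order of a
    torsion-free group of rank one is 1 or -1 ([sign_action]).  Let C be the set
    of the b for which both signs are +1 ([core]).  On C the product star is
    additive in the first argument with values in the torsion-free group I and
    vanishes on a non-trivial power of each element, so C is a trivial sub-skew
    brace ([core_trivial]).  It contains all squares of (B, o), hence equals the
    subgroup of squares and has index two.  An element a outside C acts on C by
    the signs of lambda_a and lambda^op_a.  They are not both +1 by definition
    of C, and both being -1 would force a o a = 0 ([noncore_sign]).  The two
    remaining possibilities are the two cases of the theorem, exchanged by
    passing to the opposite brace; in both a inverts C in (B, +), whence a + a = 0.
    The powers of a o a o a form a sub-skew brace that is not normal in (B, +).

    For the converse let s be the sign character of X with kernel X^2.  The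
    operation y + z = y o z^s(y) is a group operation which makes (X, +, o) a skew
    brace with lambda_y(z) = z^s(y) ([twist_brace]).  It obeys the first set of
    rules and its opposite obeys the second; each set of rules determines the
    sum of any two elements because X is the union of X^2 and x o X^2. *)

Set Implicit Arguments.
Unset Strict Implicit.
Unset Printing Implicit Defensive.

Import Order.TTheory GRing.Theory Num.Theory.
Local Open Scope classical_set_scope.

(** * Commutative radical rings whose adjoint group has rank one *)

(** The ring is given as an ideal R of a unital ring A such that 1 + R is a
    group, namely the adjoint group of R. *)
Section RadicalRing.
Local Open Scope ring_scope.
Variables (A : comNzRingType) (R : A -> Prop).
Hypothesis RD : forall x y, R x -> R y -> R (x + y).
Hypothesis RM : forall a x, R x -> R (a * x).
Hypothesis RV : forall x, R x -> exists y, (1 + x) * y = 1.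
Hypothesis Rtf : forall x n, R x -> (0 < n)%N -> (1 + x) ^+ n = 1 -> x = 0.
Hypothesis Rcomm : forall x y, R x -> R y -> x != 0 -> y != 0 ->
  exists a b, [/\ (0 < a)%N, (0 < b)%N &
    (1 + x) ^+ a = (1 + y) ^+ b \/ (1 + x) ^+ a * (1 + y) ^+ b = 1].

Let ev (x : A) (P : {poly int}) : A := (map_poly intr P).[x].

Lemma radical_cancel x y : R y -> x * (1 + y) = 0 -> x = 0.
Proof.
move=> /RV[z yz] xy; rewrite - [x]mulr1 -yz mulrA xy mul0r //.
Qed.

Lemma radicalX x k : R x -> (0 < k)%N -> R (x ^+ k).
Proof. by case: k => // k Rx _; rewrite exprSr; apply: RM. Qed.

Lemma radicalMr x a : R x -> R (x * a).
Proof. by rewrite mulrC; apply: RM. Qed.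

(** The second element 1 + x + x^2 takes the value 1 at x = -1, where 1 + x
    vanishes; so a relation between powers of the two remains a non-trivial
    polynomial identity modulo every prime. *)
Lemma integral_relation x : R x -> x != 0 ->
  exists P : {poly int}, [/\ ev x P = 0, P`_0 = 0 & P.[-1] = -1].
Proof.
move=> Rx xN0.
have Rx2 : R (x + x ^+ 2) by apply: RD => //; apply: radicalX.
have yN0 : x + x ^+ 2 != 0.
  apply: contra_neq xN0 => yE; apply: (radical_cancel Rx).
  by rewrite -yE; ring.
pose p := 1 + 'X : {poly int}; pose q := 1 + ('X + 'X ^+ 2) : {poly int}.
have evp n : ev x (p ^+ n) = (1 + x) ^+ n.
  by rewrite /ev rmorphXn horner_exp rmorphD rmorph1 /= map_polyX !hornerE.
have evq n : ev x (q ^+ n) = (1 + (x + x ^+ 2)) ^+ n.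
  rewrite /ev rmorphXn horner_exp !rmorphD rmorph1 /= rmorphXn /= map_polyX.
  by rewrite !hornerE.
have [a [b [a0 b0 E]]] := Rcomm Rx Rx2 xN0 yN0.
have a0' : (0 ^+ a : int) = 0 by rewrite expr0n; case: (a) a0.
have pN1 : (p ^+ a).[-1] = 0 by rewrite horner_exp !hornerE /= subrr a0'.
have qN1 : (q ^+ b).[-1] = 1.
  by rewrite horner_exp !hornerE /= [X in X ^+ b](_ : _ = 1) // expr1n.
have p0 n : (p ^+ n).[0] = 1 by rewrite horner_exp !hornerE expr1n.
have q0 n : (q ^+ n).[0] = 1 by rewrite horner_exp !hornerE expr1n.
case: E => E.
- exists (p ^+ a - q ^+ b); split.
  + by rewrite /ev rmorphB hornerD hornerN -!/(ev _ _) evp evq E subrr.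
  + by rewrite -horner_coef0 hornerD hornerN p0 q0 subrr.
  + by rewrite hornerD hornerN pN1 qN1.
- exists (p ^+ a * q ^+ b - 1); split.
  + by rewrite /ev rmorphB rmorphM rmorph1 !hornerE -!/(ev _ _) evp evq E subrr.
  + by rewrite - horner_coef0 hornerD hornerM hornerN hornerC p0 q0 subrr.
  + by rewrite hornerD hornerM hornerN hornerC pN1 qN1.
Qed.

Lemma ev_tail x (h : {poly int}) : exists w, ev x h = (h`_0)%:~R + x * w.
Proof.
elim/poly_ind: h => [|h c _].
  by exists 0; rewrite /ev rmorph0 horner0 coef0 mulr0 addr0.
exists (ev x h).
rewrite /ev rmorphD rmorphM /= map_polyX map_polyC /= !hornerE /=.
by rewrite coefD coefMX coefC /= add0r mulrC addrC.
Qed.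

Lemma exp1D_sqr0 (z : A) n : z ^+ 2 = 0 -> (1 + z) ^+ n = 1 + z *+ n.
Proof.
move=> z2; elim: n => [|n IHn]; first by rewrite expr0 addr0.
rewrite exprS IHn -!(mulr_natl z) -natr1.
by transitivity (1 + (n%:R + 1) * z + n%:R * z ^+ 2); [ring | rewrite z2 mulr0 addr0].
Qed.

(** A non-zero nilpotent element has a non-zero power with zero square. *)
Lemma nilp_eq0 (Q : A -> Prop) x k :
    (forall j, (0 < j)%N -> Q (x ^+ j)) -> (forall z, Q z -> z ^+ 2 = 0 -> z = 0) ->
  x ^+ k.+1 = 0 -> x = 0.
Proof.
move=> Qx Qr; elim: k => [|k IHk]; first by rewrite expr1.
move=> xk; apply/IHk/Qr; first exact: Qx.
by rewrite -exprM muln2 -addnn addSnnS exprD xk mulr0.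
Qed.

(** Modulo p the relation reads x^k h(x) = 0 with h(0) invertible; then h(x) is
    a unit because x lies in the radical, so x is nilpotent, and a non-zero z with
    p z = 0 and z^2 = 0 gives the torsion element 1 + z. *)
Lemma radical_p_torsionfree p x : prime p -> R x -> x *+ p = 0 -> x = 0.
Proof.
move=> p_pr Rx px; apply/eqP/negPn/negP => xN0.
have [P [Px P0 PN1]] := integral_relation Rx xN0.
have exi : exists i, ~~ (p %| P`_i)%Z.
  apply/not_existsP => dv; suff: (p %| (-1 : int))%Z.
    by rewrite dvdzE /= dvdn1 => /eqP p1; rewrite p1 in p_pr.
  rewrite -PN1 horner_coef rpred_sum // => i _.
  by rewrite dvdz_mulr //; apply/negPn/negP/dv.
case: (ex_minnP exi) => k pPk kmin.
have k0 : (0 < k)%N by rewrite lt0n; apply: contraNneq pPk => ->; rewrite P0 dvdz0.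
have pxk (z : A) : p%:R * (x * z) = 0.
  by rewrite mulrA mulr_natl px mul0r.
have [w hw] := ev_tail x (drop_poly k P).
have xkh : x ^+ k * ev x (drop_poly k P) = 0.
  rewrite -Px - [in RHS](poly_take_drop k P) /ev rmorphD rmorphM /= map_polyXn.
  rewrite hornerD hornerM hornerXn mulrC.
  rewrite [X in _ = X + _](_ : _ = 0) ?add0r // horner_coef big1 // => i _.
  rewrite coef_map coef_take_poly; case: ltnP => [ik|_]; last by rewrite mul0r.
  case: (posnP i) => [->|i0]; first by rewrite P0 mul0r.
  have /dvdzP[c ->] : (p %| P`_i)%Z.
    by apply/negPn/negP => /kmin; rewrite leqNgt ik.
  rewrite /= rmorphM /= -mulrA -(prednK i0) exprS.
  by rewrite - [p%:~R]/(p%:R) pxk mulr0.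
move: hw; rewrite coef_drop_poly add0n => hw.
have /coprimezP[[u v] /= uv] : coprimez P`_k p.
  by rewrite coprimezE coprime_sym prime_coprime // -dvdzE.
have xk0 : x ^+ k = 0.
  apply: (@radical_cancel _ (u%:~R * (x * w))); first exact/RM/radicalMr.
  have uvA : u%:~R * (P`_k)%:~R + v%:~R * p%:R = 1 :> A.
    by rewrite - [p%:R]/((p : int)%:~R) -!rmorphM -rmorphD uv.
  move: uvA hw; move: (u%:~R) (v%:~R) (P`_k)%:~R => U V N <- hw.
  transitivity (U * (x ^+ k * ev x (drop_poly k P)) + V * (p%:R * (x * x ^+ k.-1))).
    by rewrite hw -exprS prednK //; ring.
  by rewrite xkh pxk !mulr0 addr0.
move: xN0; rewrite (@nilp_eq0 (fun z => R z /\ z *+ p = 0) x k.-1) ?eqxx //; last first.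
- by rewrite prednK.
- move=> z [Rz pz] z2; apply: (@Rtf z p Rz (prime_gt0 p_pr)).
  by rewrite exp1D_sqr0 // pz addr0.
- move=> [//|j] _; split; first exact: radicalX.
  by rewrite exprS -mulrnAl px mul0r.
Qed.

Lemma radical_torsionfree n x : (0 < n)%N -> R x -> x *+ n = 0 -> x = 0.
Proof.
elim/ltn_ind: n x => n IHn x n0 Rx nx.
have [n1|n1] := leqP n 1; first by have -> : x = x *+ n by rewrite (_ : n = 1)%N //; lia.
have p_pr := pdiv_prime n1.
have /dvdnP[m nE] := pdiv_dvd n.
have m0 : (0 < m)%N by move: n0; rewrite nE muln_gt0 => /andP[].
apply: (IHn m) => //.
  by rewrite [ltnRHS]nE - [ltnLHS]muln1 ltn_mul2l m0 prime_gt1.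
apply: (radical_p_torsionfree p_pr); first by rewrite -mulr_natl; apply: RM.
by rewrite -mulrnA -nE.
Qed.

Lemma radical_torsionfreez (m : int) x : m != 0 -> R x -> m%:~R * x = 0 -> x = 0.
Proof.
move=> m0 Rx mx; apply: (@radical_torsionfree `|m|%N) => //.
  by rewrite absz_gt0.
move: mx; rewrite mulrzl; case: (intP m) => [|n|n] //.
by rewrite abszN mulrNz => /eqP; rewrite oppr_eq0 => /eqP.
Qed.

(** The element v acts on itself as the integer N, so 1 + v and 1 + 2 v act as
    1 + N and 1 + 2 N.  These integers are coprime, so a multiplicative relation
    between them makes both equal to 1 or -1, which leaves N = 0. *)
Lemma radical_no_rescaled_idempotent v (N : int) :
  R v -> N != 0 -> v ^+ 2 = N%:~R * v -> v = 0.
Proof.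
move=> Rv N0 v2; apply/eqP/negPn/negP => vN0.
have vn (c : A) : (1 + c) * v = v + c * v by rewrite mulrDl mul1r.
have R2v : R (2 * v) by apply: RM.
have v20 : 2 * v != 0.
  by apply: contra_neq vN0 => /(@radical_torsionfreez 2 v isT Rv).
have pow (t : int) (c : A) n : c = t%:~R -> (1 + c * v) ^+ n * v = ((1 + t * N) ^+ n)%:~R * v.
  move=> cE; elim: n => [|n IHn]; first by rewrite !expr0.
  rewrite exprS -mulrA IHn mulrCA mulrDl mul1r -mulrA -expr2 v2 !exprS.
  by rewrite !rmorphM rmorphD rmorphM /= cE; ring.
have inj (m n : int) : m%:~R * v = n%:~R * v -> m = n.
  move=> mn; apply/eqP; rewrite -subr_eq0; apply: contra_neqT vN0 => mn0.
  by apply: (@radical_torsionfreez (m - n)) => //; rewrite rmorphB mulrBl mn subrr.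
have [a [b [a0 b0 E]]] := Rcomm Rv R2v vN0 v20.
have pa := pow 1 1 a erefl; have pb := pow 2 2 b erefl; rewrite !mul1r in pa.
have cop : coprimez ((1 + N) ^+ a) ((1 + 2 * N) ^+ b).
  apply/coprimezXl/coprimezXr/coprimezP; exists (2, -1) => /=; ring.
have un (x : int) n : (0 < n)%N -> (`|x ^+ n| = 1)%N -> (`|x| = 1)%N.
  by move=> n0; rewrite abszX -(prednK n0) expnS => /eqP; rewrite muln_eq1 => /andP[/eqP].
have [ua ub] : (`|(1 + N) ^+ a| = 1)%N /\ (`|(1 + 2 * N) ^+ b| = 1)%N.
  case: E => E.
    move: pb; rewrite -E pa => /inj E'; move: cop.
    by rewrite -E' coprimezE /coprime gcdnn => /eqP.
  have /inj : ((1 + N) ^+ a * (1 + 2 * N) ^+ b)%:~R * v = 1%:~R * v.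
    by rewrite rmorphM /= -mulrA -pb mulrCA -pa mulrA (mulrC (_ ^+ b)) E.
  move=> /(congr1 absz)/eqP; rewrite abszM /= muln_eq1 => /andP[/eqP + /eqP].
  by [].
by move: (un _ _ a0 ua) (un _ _ b0 ub) N0; lia.
Qed.

(** Let x^k h(x) = 0 with h(0) = N <> 0.  The element u = N - h(x) of R satisfies
    x^k u = N x^k, so v = u^k satisfies v^2 = N^k v and vanishes; then
    N^k x^k = x^k u^k = 0. *)
Lemma radical_nilp x : R x -> exists k, x ^+ k.+1 = 0.
Proof.
move=> Rx; have [->|xN0] := eqVneq x 0; first by exists 0%N; rewrite expr1.
have [P [Px P0 PN1]] := integral_relation Rx xN0.
have PN0 : P != 0 by apply/eqP => PE; move: PN1; rewrite PE horner0.
have [k [h]] := multiplicity_XsubC P 0; rewrite PN0 /= => h0 PE.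
have hN0 : h`_0 != 0 by rewrite -horner_coef0.
have k0 : (0 < k)%N.
  rewrite lt0n; apply: contra_neq hN0 => kE.
  by move: P0; rewrite PE kE expr0 mulr1.
exists k.-1; rewrite prednK //.
have [w hw] := ev_tail x h.
set N := h`_0 in hN0 hw.
pose u := x * (- w).
have xu : x ^+ k * u = N%:~R * x ^+ k.
  apply/eqP; rewrite -subr_eq0; apply/eqP.
  transitivity (- (ev x h * x ^+ k)); first by rewrite hw /u; ring.
  move: Px; rewrite PE /ev rmorphM rmorphXn rmorphB /= map_polyX rmorph0 subr0.
  by rewrite hornerM hornerXn => ->; rewrite oppr0.
have xuX n : x ^+ k * u ^+ n = N%:~R ^+ n * x ^+ k.
  elim: n => [|n IHn]; first by rewrite !expr0 mulr1 mul1r.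
  by rewrite exprSr mulrA IHn -mulrA xu exprSr mulrA.
have Nk0 : N ^+ k != 0 by rewrite expf_neq0.
have uk0 : u ^+ k = 0.
  apply: (@radical_no_rescaled_idempotent _ (N ^+ k)) => //.
    by apply: radicalX => //; apply: radicalMr.
  have ukE : u ^+ k = x ^+ k * (- w) ^+ k by rewrite exprMn.
  by rewrite expr2 [X in X * _]ukE mulrAC xuX -mulrA -ukE rmorphXn.
apply: (@radical_torsionfreez (N ^+ k)) => //; first exact: radicalX.
by rewrite rmorphXn /= -xuX uk0 mulr0.
Qed.

(** If x z is non-zero, commensurability of 1 + x and 1 + x z makes z act on x
    as a non-zero rational number, which a nilpotent element cannot do. *)
Lemma radical_sqr0_ann x z : R x -> R z -> x ^+ 2 = 0 -> x * z = 0.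
Proof.
move=> Rx Rz x2; have [->|xN0] := eqVneq x 0; first by rewrite mul0r.
apply/eqP/negPn/negP => wN0.
have Rw : R (x * z) by apply: RM.
have w2 : (x * z) ^+ 2 = 0 by rewrite exprMn x2 mul0r.
have xw : x * (x * z) = 0 by rewrite mulrA -expr2 x2 mul0r.
have [a [b [a0 b0 E]]] := Rcomm Rx Rw xN0 wN0.
have [l xl] : exists l : int, a%:~R * x = l%:~R * (x * z).
  case: E; rewrite !exp1D_sqr0 //.
    move=> /addrI E; exists b; rewrite -!pmulrn !mulr_natl //.
  rewrite -(mulr_natl x) -(mulr_natl (x * z)).
  have -> : (1 + a%:R * x) * (1 + b%:R * (x * z)) =
      1 + (a%:R * x + b%:R * (x * z)) + a%:R * b%:R * (x * (x * z)) by ring.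
  rewrite xw mulr0 addr0 => E; exists (- b%:Z); rewrite rmorphN mulNr.
  by apply/eqP; rewrite -addr_eq0; apply/eqP/(addrI 1); rewrite E addr0.
have xlX n : (a%:Z ^+ n)%:~R * x = (l ^+ n)%:~R * (x * z ^+ n).
  elim: n => [|n IHn]; first by rewrite !expr0 mulr1.
  rewrite !exprS !rmorphM -mulrA IHn.
  transitivity ((l ^+ n)%:~R * z ^+ n * (a%:~R * x)); first by ring.
  by rewrite xl; ring.
have [k zk] := radical_nilp Rz.
move/eqP: xN0; apply; apply: (@radical_torsionfreez (a%:Z ^+ k.+1)) => //.
  by rewrite expf_neq0 //; lia.
by rewrite xlX zk !mulr0.
Qed.

(** A vanishing power x^j with j > 3 can be lowered to x^3 = 0, as powers with
    zero square annihilate R.  From x^3 = 0 the relation between 1 + x and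
    1 + x^2, multiplied by x, gives a x^2 = 0 with a > 0. *)
Lemma radical_sqr0 x : R x -> x ^+ 2 = 0.
Proof.
move=> Rx; have [k] := radical_nilp Rx.
have red j : x ^+ j.+4 = 0 -> x ^+ j.+3 = 0.
  move=> xj; rewrite exprSr; apply: radical_sqr0_ann => //; first exact: radicalX.
  by rewrite -exprM (_ : (j.+2 * 2 = j.+4 + j)%N); [rewrite exprD xj mul0r | lia].
have cub : x ^+ 3 = 0 -> x ^+ 2 = 0.
  move=> x3; have x2R : R (x ^+ 2) by apply: radicalX.
  have [//|x20] := eqVneq (x ^+ 2) 0.
  have xN0 : x != 0 by apply: contra_neq x20 => ->; rewrite expr0n.
  have x22 : (x ^+ 2) ^+ 2 = 0 by rewrite -exprM (exprD x 3 1) x3 mul0r.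
  have xX n : (1 + x) ^+ n * x = x + x ^+ 2 *+ n.
    elim: n => [|n IHn]; first by rewrite expr0 mul1r addr0.
    rewrite exprS -mulrA IHn -!(mulr_natl (x ^+ 2)) -natr1.
    transitivity (x + (n%:R + 1) * x ^+ 2 + n%:R * x ^+ 3); first by ring.
    by rewrite x3 mulr0 addr0.
  have yX n : (1 + x ^+ 2) ^+ n * x = x.
    by rewrite exp1D_sqr0 // mulrDl mul1r mulrnAl -exprSr x3 mul0rn addr0.
  have [a [b [a0 b0 E]]] := Rcomm Rx x2R xN0 x20.
  apply: (radical_torsionfree a0) => //; apply: (addrI x); rewrite addr0 -xX.
  case: E => [->|E]; first exact: yX.
  by have := congr1 (fun t => t * x) E; rewrite mul1r -mulrA yX.
elim: k => [|[|[|k]] IHk] //.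
- by rewrite expr1 => ->; rewrite expr0n.
- by move=> /red.
Qed.

Lemma radical_mul0 x y : R x -> R y -> x * y = 0.
Proof. by move=> Rx Ry; apply: radical_sqr0_ann => //; apply: radical_sqr0. Qed.

End RadicalRing.

(** * Groups, their powers and generated subgroups *)

Section GroupTheory.
Variables (T : Type) (G : group T).
Local Notation "x * y" := (gop G x y).
Local Notation "1" := (gid G).
Local Notation "x ^-1" := (ginv G x).

Lemma gassoc x y z : x * y * z = x * (y * z). Proof. by rewrite gopA. Qed.
Lemma gmulKV x y : x * (x^-1 * y) = y. Proof. by rewrite gopA gopxV gop1x. Qed.
Lemma gmulVK x y : x^-1 * (x * y) = y. Proof. by rewrite gopA gopVx gop1x. Qed.

Lemma gmulI x y z : x * y = x * z -> y = z.
Proof. by move=> e; rewrite -(gmulVK x y) e gmulVK. Qed.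

Lemma gmulIr x y z : y * x = z * x -> y = z.
Proof. by move=> e; rewrite -(gopx1 G y) -(gopxV G x) gopA e gassoc gopxV gopx1. Qed.

Lemma ginv_unique x y : x * y = 1 -> y = x^-1.
Proof. by move=> e; apply: (@gmulI x); rewrite e gopxV. Qed.

Lemma ginvK x : x^-1^-1 = x.
Proof. by symmetry; apply: ginv_unique; rewrite gopVx. Qed.
Lemma ginv1 : 1^-1 = 1.
Proof. by symmetry; apply: ginv_unique; rewrite gop1x. Qed.
Lemma ginvM x y : (x * y)^-1 = y^-1 * x^-1.
Proof. by symmetry; apply: ginv_unique; rewrite gassoc gmulKV gopxV. Qed.

(** Rewriting with these rules normalizes group words: products are associated
    to the right, inverses pushed to the letters, adjacent inverses cancelled. *)
Definition gE := (gassoc, ginvM, ginvK, ginv1, gop1x, gopx1, gopVx, gopxV, gmulKV, gmulVK).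

Lemma generated_subgroup S : subgroup G (generated G S).
Proof.
split=> [P [[]]//|x y Sx Sy P PS|x Sx P PS].
- by case: (PS) => - [_ PM _] _; apply: PM; [exact: Sx|exact: Sy].
- by case: (PS) => - [_ _ PV] _; apply: PV; exact: Sx.
Qed.

Lemma generated_min S P : subgroup G P -> S `<=` P -> generated G S `<=` P.
Proof. by move=> sP SP x; apply; split. Qed.

Lemma sub_generated (S : set T) x : S x -> generated G S x.
Proof. by move=> Sx P [_]; apply. Qed.

Lemma generated_morph (f : T -> T) S :
  (forall x y, f (x * y) = f x * f y) -> (forall x, S x -> generated G S (f x)) ->
  forall x, generated G S x -> generated G S (f x).
Proof.
move=> fM fS; have [g1 gM gV] := generated_subgroup S.
have f1 : f 1 = 1 by apply: (@gmulI (f 1)); rewrite -fM gop1x gopx1.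
apply: generated_min => //; split=> [|x y|x] /=; first by rewrite f1.
- by rewrite fM; apply: gM.
- by move=> /gV; rewrite (@ginv_unique (f x) (f (x^-1))) // -fM gopxV f1.
Qed.

Lemma centralizer_subgroup (P : set T) :
  subgroup G [set x | forall y, P y -> x * y = y * x].
Proof.
split=> [y _|x z cx cz y Py|x cx y Py] /=; first by rewrite gop1x gopx1.
- by rewrite gassoc cz // gopA cx // gassoc.
- by apply: (@gmulI x); rewrite gmulKV gopA cx // gassoc gopxV gopx1.
Qed.

Lemma generated_abelian (S : set T) :
  (forall x y, S x -> S y -> x * y = y * x) ->
  forall x y, generated G S x -> generated G S y -> x * y = y * x.
Proof.
move=> cS.
have c1 : generated G S `<=` [set x | forall y, S y -> x * y = y * x].
  by apply: generated_min; [exact: centralizer_subgroup | move=> x Sx y; exact: cS].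
have c2 : generated G S `<=` [set x | forall y, generated G S y -> x * y = y * x].
  apply: generated_min; first exact: centralizer_subgroup.
  by move=> x Sx y Gy; rewrite (c1 y).
by move=> x y /c2; apply.
Qed.

End GroupTheory.

Lemma group_eq (T : Type) (G H : group T) : gop G = gop H -> G = H.
Proof.
case: G => o1 e1 v1 A1 l1 r1 lV1 rV1; case: H => o2 e2 v2 A2 l2 r2 lV2 rV2 /= e.
subst o2.
have e12 : e1 = e2 by rewrite -(l2 e1) r1.
subst e2.
have v12 : v1 = v2.
  apply/funext => x; symmetry.
  exact: (@ginv_unique _ (Defs.Group A1 l1 r1 lV1 rV1) x (v2 x) (rV2 x)).
subst v2.
by f_equal; apply: Prop_irrelevance.
Qed.

Section SubgroupPowers.
Variables (T : Type) (G : group T) (S : set T) (hS : subgroup G S).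

Lemma val_gpow (x : S) n : val (gpow (subg hS) x n) = gpow G (val x) n.
Proof. by elim: n => [|n IHn] //=; rewrite -IHn. Qed.

End SubgroupPowers.

(** * Abelian groups as modules over the integers *)

(** The type carries no structure of its own, so an abelian group record can be
    given a [zmodType] without interfering with the other group structures on
    the same carrier. *)
Definition zmod_of (T : Type) (G : group T) of commutative (gop G) : Type := T.

Section ZmodOf.
Variables (T : Type) (G : group T) (hG : commutative (gop G)).
HB.instance Definition _ := gen_eqMixin (zmod_of hG).
HB.instance Definition _ := gen_choiceMixin (zmod_of hG).
HB.instance Definition _ := GRing.isZmodule.Build (zmod_of hG)
  (@gopA _ G) hG (@gop1x _ G) (@gopVx _ G).

Lemma zmod_gpow (x : zmod_of hG) n : gpow G x n = (x *+ n)%R.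
Proof. by elim: n => [|n IHn]; rewrite ?mulr0n // mulrS -IHn. Qed.

Lemma zmod_tf : torsion_free G ->
  forall (x : zmod_of hG) (m : int), m <> 0%R -> (x *~ m = 0)%R -> x = 0%R.
Proof.
move=> tf x m m0 xm; apply: (tf x `|m|%N); first by lia.
rewrite zmod_gpow; change (x *+ `|m| = 0)%R.
by case: (intP m) xm => [|n|n] //; rewrite abszN mulrNz => /eqP; rewrite oppr_eq0 => /eqP.
Qed.

Lemma subgroup_mulrz (S : set T) (x : zmod_of hG) (m : int) :
  subgroup G S -> S x -> S (x *~ m)%R.
Proof.
case=> S1 SM SV Sx; have Sn n : S (x *+ n)%R.
  by elim: n => [|n IHn]; rewrite ?mulr0n // mulrS; apply: SM.
case: (intP m) => [|n|n]; rewrite ?mulr0z //; first exact: Sn.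
by rewrite mulrNz; apply/SV/Sn.
Qed.

End ZmodOf.

Lemma multiples_subgroup (T : Type) (G : group T) (hG : commutative (gop G)) (g : zmod_of hG) :
  subgroup G [set z | exists i, z = (g *~ i)%R].
Proof.
split=> [|_ _ [i ->] [j ->]|_ [i ->]]; first by exists 0%R.
- by exists (i + j)%R; rewrite mulrzDr.
- by exists (- i)%R; rewrite mulrNz.
Qed.

Definition pair_cyclic (V : zmodType) :=
  forall x y : V, exists g i j, x = (g *~ i)%R /\ y = (g *~ j)%R.

Section RankOne.
Local Open Scope ring_scope.
Variables (V : zmodType).
Hypothesis cV : pair_cyclic V.

(** Write both elements as multiples of a common g: the coefficients are odd,
    as they are not doubles, so their sum is even. *)
Lemma nondoubles_sum_double (x y : V) :
  ~ (exists z, x = z + z) -> ~ (exists z, y = z + z) -> exists z, x + y = z + z.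
Proof.
have [g [i [j [-> ->]]]] := cV x y => Hx Hy.
have odd k : ~ (exists z, g *~ k = z + z) -> exists q, k = 2 * q + 1.
  move=> nk; exists (k %/ 2)%Z; rewrite [LHS](divz_eq k 2) mulrC.
  congr (_ + _); have [k0|//] : (k %% 2)%Z = 0 \/ (k %% 2)%Z = 1.
    by have := modz_ge0 k (isT : 2 != 0 :> int); have := ltz_pmod k (isT : 0 < 2 :> int); lia.
  case: nk; exists (g *~ (k %/ 2)%Z); rewrite -mulrzDr; congr (_ *~ _).
  by rewrite {1}(divz_eq k 2) k0; lia.
have [[p ->] [q ->]] := (odd _ Hx, odd _ Hy).
by exists (g *~ (p + q + 1)); rewrite -!mulrzDr; congr (_ *~ _); lia.
Qed.

Lemma rank_one (x y : V) : x <> 0 -> y <> 0 ->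
  exists m l : int, [/\ m <> 0, l <> 0 & x *~ m = y *~ l].
Proof.
have [g [i [j [-> ->]]]] := cV x y => x0 y0; exists j, i.
split; last by rewrite -!mulrzA mulrC.
- by move=> j0; apply: y0; rewrite j0 mulr0z.
- by move=> i0; apply: x0; rewrite i0 mulr0z.
Qed.
End RankOne.

Definition commensurable (T : Type) (G : group T) :=
  forall x y, x <> gid G -> y <> gid G ->
  exists a b, [/\ (0 < a)%N, (0 < b)%N &
    gpow G x a = gpow G y b \/ gop G (gpow G x a) (gpow G y b) = gid G].

Lemma pair_cyclic_commensurable (T : Type) (G : group T) (hG : commutative (gop G)) :
  pair_cyclic (zmod_of hG) -> commensurable G.
Proof.
move=> cG x y x0 y0.
have [m [l [m0 l0 E]]] := rank_one (V := zmod_of hG) cG x0 y0.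
exists `|m|%N, `|l|%N; split; [lia|lia|].
have absP (u : zmod_of hG) (k : int) : gpow G u `|k|%N = (u *~ (sgz k * k))%R.
  by rewrite (zmod_gpow (hG := hG)) -abszEsg.
rewrite !absP; change (gop G) with (@GRing.add (zmod_of hG)).
change (gid G) with (0%R : zmod_of hG).
rewrite [(sgz m * m)%R]mulrC [(sgz l * l)%R]mulrC !mulrzA E.
by case: sgzP m0 => // _ _; case: sgzP l0 => // _ _;
  rewrite ?mulrN1z ?mulr1z ?addNr ?addrN; [left|right|right|left].
Qed.

(** * Skew braces with commutative multiplicative group *)

Section BraceTheory.
Variables (T : Type) (B : skewBrace T).
Local Notation "x + y" := (gop (addg B) x y).
Local Notation "- x" := (ginv (addg B) x).
Local Notation "x - y" := (gop (addg B) x (ginv (addg B) y)).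
Local Notation "0" := (gid (addg B)).
Local Notation "x ∘ y" := (gop (mulg B) x y) (at level 40, left associativity).
Local Notation "x ^-1" := (ginv (mulg B) x).
Local Notation lam := (lambda B).

(** The identities of the two groups coincide: take b = c = 0 in the brace law. *)
Lemma mulx0 a : a ∘ 0 = a.
Proof.
have := braceP B a 0 0; rewrite gop1x gassoc => e.
have := gmulI (etrans (gopx1 _ (a ∘ 0)) e) => e'.
by apply: (@gmulI _ (addg B) (- a)); rewrite -e' gopVx.
Qed.

Lemma mulg_id : gid (mulg B) = 0.
Proof. by rewrite - [LHS]mulx0 gop1x. Qed.

Lemma mul0x a : 0 ∘ a = a. Proof. by rewrite -mulg_id gop1x. Qed.
Lemma mulxV a : a ∘ a^-1 = 0. Proof. by rewrite gopxV mulg_id. Qed.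
Lemma mulVx a : a^-1 ∘ a = 0. Proof. by rewrite gopVx mulg_id. Qed.

Lemma mulE a b : a ∘ b = a + lam a b.
Proof. by rewrite /lambda gmulKV. Qed.

Lemma lambdaD a b c : lam a (b + c) = lam a b + lam a c.
Proof. by rewrite /lambda braceP !gE. Qed.

Lemma lambda0r a : lam a 0 = 0.
Proof. by rewrite /lambda mulx0 gopVx. Qed.

Lemma lambda0l b : lam 0 b = b.
Proof. by rewrite /lambda mul0x ginv1 gop1x. Qed.

Lemma lambdaN a b : lam a (- b) = - lam a b.
Proof. by apply: ginv_unique; rewrite -lambdaD gopxV lambda0r. Qed.

Lemma lambdaM a b c : lam (a ∘ b) c = lam a (lam b c).
Proof. by rewrite {3}/lambda lambdaD lambdaN /lambda !gE. Qed.

Lemma lambdaK a : cancel (lam a) (lam a^-1).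
Proof. by move=> b; rewrite -lambdaM mulVx lambda0l. Qed.

Lemma lambdaVK a : cancel (lam a^-1) (lam a).
Proof. by move=> b; rewrite -lambdaM mulxV lambda0l. Qed.

Lemma addE a b : a + b = a ∘ lam a^-1 b.
Proof. by rewrite mulE lambdaVK. Qed.

Lemma oppE a : - a = lam a a^-1.
Proof. by symmetry; apply: ginv_unique; rewrite -mulE mulxV. Qed.

Lemma invE a : a^-1 = lam a^-1 (- a).
Proof. by rewrite oppE lambdaK. Qed.

Lemma lambda_oppE a b : lambda (opp_brace B) a b = a + lam a b - a.
Proof. by rewrite -mulE. Qed.

Lemma lambda_star a b : lam a b = star B a b + b.
Proof. by rewrite /star !gE. Qed.

Lemma starDr a b c : star B a (b + c) = star B a b + (b + star B a c - b).
Proof. by rewrite /star braceP !gE. Qed.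

(** A left ideal is closed under o because a o b = a + lambda_a(b). *)
Lemma left_ideal_sub_brace (S : set T) :
  subgroup (addg B) S -> (forall b x, S x -> S (lam b x)) -> sub_skew_brace B S.
Proof.
move=> sS lS; case: (sS) => S0 SD SN; split=> //; split=> [|x y Sx Sy|x Sx].
- by rewrite mulg_id.
- by rewrite mulE; apply/SD/lS.
- by rewrite invE; apply/lS/SN.
Qed.

Lemma iter_lambda b n x : lam (gpow (mulg B) b n) x = iter n (lam b) x.
Proof.
elim: n => [|n IHn] /=; first by rewrite mulg_id lambda0l.
by rewrite lambdaM IHn.
Qed.

Section MulComm.
Hypothesis mulC : commutative (gop (mulg B)).

Lemma lambdaC a b x : lam a (lam b x) = lam b (lam a x).
Proof. by rewrite -!lambdaM mulC. Qed.

(** In the holomorph, z c d is the commutator of the element d of (B, o), acting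
    by d o x, with lambda_c.  The next two facts are the two conjugation formulas
    of Ito's proof that a product of two abelian groups is metabelian: lambda_b
    changes only the second argument and lambda^op_a only the first one. *)
Let z c d := d - lam c d.

Let zE c d : z c d = - star B c d.
Proof. by rewrite /z /star !gE. Qed.

Let lambda_z b c d : lam b (z c d) = z c (lam b d).
Proof. by rewrite /z lambdaD lambdaN lambdaC. Qed.

Let lambda_opp_z a c d : a + lam a (z c d) - a = z (c ∘ a - a) d.
Proof.
set f := c ∘ a - a; pose a' := lam f^-1 a.
have fa : f ∘ a' = c ∘ a by rewrite mulE lambdaVK /f gassoc gopVx gopx1.
have key : a + lam a (lam c d) = lam f d + lam d a.
  have aE : lam f a' = a by rewrite lambdaVK.
  by rewrite -lambdaM (mulC a) -fa lambdaM - [X in X + _]aE -lambdaD -mulE mulC mulE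
    lambdaD lambdaC aE.
rewrite {1}/z lambdaD lambdaN gopA -mulE gassoc -ginvM key mulC mulE.
by rewrite ginvM gassoc gmulKV.
Qed.

(** Hence lambda_y and lambda^op_x commute on these commutators, which says that
    conjugation by x and by lambda_y(x) agree on them. *)
Lemma star_commute a b c d :
  star B a b + star B c d = star B c d + star B a b.
Proof.
have conj_z x y e : x + z c e - x = lam y x + z c e - lam y x.
  pose d0 := lam y^-1 (lam x^-1 e).
  have eE : lam x (lam y d0) = e by rewrite !lambdaVK.
  transitivity (lam y (x + lam x (z c d0) - x)).
    by rewrite lambda_opp_z lambda_z -lambda_opp_z lambda_z eE.
  by rewrite 2!lambdaD lambdaN !lambda_z - [lam y (lam x _)]lambdaC eE.
have comm_w (w l : T) : - b + w + b = - l + w + l -> (l - b) - w = - w + (l - b).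
  move=> e; apply: (@gmulI _ (addg B) w); rewrite gmulKV; apply: (@gmulIr _ (addg B) w).
  have := congr1 (fun t => l + t) e; rewrite !gE => e'.
  by apply: (@gmulIr _ (addg B) b); rewrite !gE e'.
have := conj_z (- b) a d; rewrite lambdaN !ginvK => /comm_w.
by rewrite - [- z c d](_ : star B c d = _) // zE ginvK.
Qed.

(** This is the ideal written B * B or B^2. *)
Definition star_square := star_set B setT setT.

Lemma mem_star_square a b : star_square (star B a b).
Proof. by apply: sub_generated; exists a, b. Qed.

Lemma star_square_subgroup : subgroup (addg B) star_square.
Proof. exact: generated_subgroup. Qed.

Lemma star_square_lambda b x : star_square x -> star_square (lam b x).
Proof.
apply: generated_morph; first exact: lambdaD.
move=> _ [c [d [_ _ ->]]]; have -> : lam b (star B c d) = star B c (lam b d).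
  by rewrite /star -!/(lambda B c _) lambdaD lambdaN lambdaC.
exact: mem_star_square.
Qed.

(** By the brace law b + c * d - b = - (c * b) + c * (b + d). *)
Lemma star_square_conj b x : star_square x -> star_square (b + x - b).
Proof.
apply: (generated_morph (f := fun x => b + x - b)) => [u v|_ [c [d [_ _ ->]]]].
  by rewrite !gE.
have -> : b + star B c d - b = - star B c b + star B c (b + d).
  by rewrite starDr gmulVK.
have [_ ID IN] := star_square_subgroup.
by apply: ID; [apply: IN|]; apply: mem_star_square.
Qed.

Lemma star_square_addC x y : star_square x -> star_square y -> x + y = y + x.
Proof.
apply: generated_abelian => _ _ [a [b [_ _ ->]]] [c [d [_ _ ->]]].
exact: star_commute.
Qed.

End MulComm.
End BraceTheory.

Arguments mem_star_square {T} B a b.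
Arguments star_square_lambda {T B} mulC b [x].
Arguments star_square_conj {T B} b [x].
Arguments star_square_addC {T B} mulC [x y].

(** * Braces with both groups abelian *)

(** The unital hull Z + V of a commutative ring without unit (the Dorroh
    extension); the ring axioms are parameters so that instances can be attached. *)
Definition dorroh (V : zmodType) (mul : V -> V -> V) of commutative mul
  & left_distributive mul +%R & associative mul : Type := (int * V)%type.

Section Dorroh.
Local Open Scope ring_scope.
Variables (V : zmodType) (st : V -> V -> V).
Hypotheses (stC : commutative st) (stDl : left_distributive st +%R)
  (stA : associative st).
Local Notation D := (dorroh stC stDl stA).

HB.instance Definition _ := GRing.Zmodule.copy D (int * V)%type.

Let stDr x y z : st x (y + z) = st x y + st x z.
Proof. by rewrite stC stDl !(stC x). Qed.

Let st0x x : st 0 x = 0.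
Proof. by apply: (addrI (st 0 x)); rewrite -stDl !addr0. Qed.

Let st_mulrzl x y (n : int) : st (x *~ n) y = st x y *~ n.
Proof.
have stn u k : st (u *+ k) y = st u y *+ k.
  by elim: k => [|k IHk]; rewrite ?mulr0n ?st0x // !mulrS stDl IHk.
case: (intP n) => [|k|k]; [by rewrite !mulr0z st0x | exact: stn | ].
rewrite !mulrNz; apply: (addrI (st (x *+ k.+1) y)).
by rewrite -stDl subrr st0x stn subrr.
Qed.

Let st_mulrzr x y (n : int) : st x (y *~ n) = st x y *~ n.
Proof. by rewrite stC st_mulrzl stC. Qed.

Let one : D := (1, 0).
Let mul (a b : D) : D := (a.1 * b.1, b.2 *~ a.1 + a.2 *~ b.1 + st a.2 b.2).

Let mulDC : commutative mul.
Proof.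
by move=> [m x] [n y]; rewrite /mul /= mulrC (addrC (y *~ m)) stC.
Qed.

Let mulDl : left_distributive mul +%R.
Proof.
move=> [m x] [n y] [p z]; rewrite /mul; apply/eqP.
rewrite -pair_eqE; apply/andP; split; apply/eqP => /=; first exact: mulrDl.
by rewrite mulrzDr mulrzDl stDl [X in X + _ = _]addrACA [LHS]addrACA.
Qed.

Let mul1D : left_id one mul.
Proof.
by move=> [m x]; rewrite /mul /= mul1r mulr1z mul0rz st0x !addr0.
Qed.

Let mulDA : associative mul.
Proof.
move=> [m x] [n y] [p z]; rewrite /mul /= mulrA; congr (_, _).
rewrite !stDr !stDl !mulrzDl stA !st_mulrzl !st_mulrzr -!mulrzA.
rewrite [(n * m)%R]mulrC [(n * p)%R]mulrC [(p * m)%R]mulrC.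
rewrite !addrA; congr (_ + _).
by rewrite [LHS](ACl (1*2*4*6*3*5)%AC).
Qed.

Let one_neq0 : one != 0.
Proof. by apply/eqP => /(congr1 fst). Qed.

HB.instance Definition _ :=
  GRing.Zmodule_isComNzRing.Build D mulDA mulDC mul1D mulDl one_neq0.

Definition dorroh_in (x : V) : D := (0, x).

Lemma dorroh_inM x y : dorroh_in x * dorroh_in y = dorroh_in (st x y).
Proof. by congr (_, _); rewrite /= !mulr0z !add0r. Qed.

Lemma dorroh_1DM x y :
  (1 + dorroh_in x) * (1 + dorroh_in y) = 1 + dorroh_in (x + y + st x y).
Proof.
rewrite mulrDl mul1r mulrDr mulr1 dorroh_inM; apply: injective_projections => /=.
  by rewrite !addr0.
by rewrite !add0r addrCA addrA.
Qed.

Lemma dorroh_ideal (a : D) x : exists y, a * dorroh_in x = dorroh_in y.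
Proof. by eexists; congr (_, _); rewrite /= ?mulr0. Qed.
End Dorroh.

Section AbelianBrace.
Variables (T : Type) (B : skewBrace T).
Hypotheses (addC : commutative (gop (addg B))) (mulC : commutative (gop (mulg B))).
Hypotheses (mul_tf : torsion_free (mulg B)) (mul_comm : commensurable (mulg B)).
Local Notation V := (zmod_of addC).

Let st (x y : V) : V := star B x y.

Let mul_st (x y : V) : gop (mulg B) x y = (x + y + st x y)%R.
Proof.
rewrite (mulE B) lambda_star.
exact: etrans (congr1 (+%R x) (addrC (st x y) y)) (addrA x y _).
Qed.

Let stC : commutative st.
Proof.
move=> x y; apply: (addrI (x + y)%R).
exact: etrans (esym (mul_st x y)) (etrans (mulC x y)
  (etrans (mul_st y x) (congr1 (+%R^~ _) (addrC y x)))).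
Qed.

Let stDr x y z : st x (y + z)%R = (st x y + st x z)%R.
Proof.
apply: etrans (starDr B x y z) _; apply: (congr1 (+%R (st x y))).
exact: etrans (congr1 (+%R^~ _) (addrC y (st x z))) (addrK y _).
Qed.

Let stDl : left_distributive st +%R.
Proof. by move=> x y z; rewrite stC stDr !(stC z). Qed.

Let stA : associative st.
Proof.
move: stC stDl stDr mul_st; move: (st) => s sC sDl sDr ms x y z.
have := gopA (mulg B) x y z; rewrite !ms !sDl !sDr => e.
apply: (addrI (x + y + z + s x y + s x z + s y z)%R).
move: e; rewrite !addrA => e.
by rewrite [RHS](ACl (1*2*4*3*5*6*7)%AC) /= -e [RHS](ACl (1*2*3*5*6*4*7)%AC).
Qed.

(** A skew brace with both groups abelian is a commutative radical ring with
    product star and adjoint group (B, o), so the ring theorem applies. *)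
Lemma abelian_brace_trivial : trivial_brace B.
Proof.
pose D := dorroh stC stDl stA.
(* The image of V is an ideal of the hull and 1 + V is the adjoint group. *)
pose R (a : D) := exists x : V, a = dorroh_in _ _ _ x.
have e0 : dorroh_in stC stDl stA (gid (mulg B)) = 0%R by rewrite mulg_id.
have RX n x : ((1 + dorroh_in stC stDl stA x) ^+ n =
    1 + dorroh_in stC stDl stA (gpow (mulg B) x n))%R.
  elim: n => [|n IHn]; first by rewrite expr0 [gpow _ _ _]/= e0 addr0.
  by rewrite exprS IHn dorroh_1DM -mul_st.
have in_inj x y : (1 + dorroh_in stC stDl stA x = 1 + dorroh_in stC stDl stA y)%R -> x = y.
  by move=> /addrI [].
have mul0 := @radical_mul0 D R _ _ _ _ _.
move=> x y.
have : (dorroh_in stC stDl stA x * dorroh_in stC stDl stA y = 0)%R.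
  apply: mul0; [| | | | | by exists x | by exists y].
  - by move=> _ _ [u ->] [v ->]; exists (u + v)%R; congr (_, _); rewrite /= addr0.
  - by move=> a _ [u ->]; have [v ->] := dorroh_ideal a u; exists v.
  - move=> _ [u ->]; exists (1 + dorroh_in stC stDl stA (ginv (mulg B) u))%R.
    by rewrite dorroh_1DM -mul_st gopxV e0 addr0.
  - move=> _ n [u ->] n0; rewrite RX - {2}[1%R]addr0 -e0 => /in_inj un.
    by rewrite (mul_tf n0 un) e0.
  - move=> _ _ [u ->] [v ->] u0 v0.
    have u1 : u <> gid (mulg B) by move=> uE; case/eqP: u0; rewrite uE e0.
    have v1 : v <> gid (mulg B) by move=> vE; case/eqP: v0; rewrite vE e0.
    have [a [b [a0 b0 E]]] := mul_comm u1 v1.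
    exists a, b; split=> //; rewrite !RX dorroh_1DM.
    by case: E => E; [left; rewrite E | right; rewrite -mul_st E e0 addr0].
rewrite dorroh_inM => /(congr1 snd) /= st0.
by rewrite mul_st (_ : st x y = 0%R) ?addr0.
Qed.
End AbelianBrace.

(** * Sign actions on a trivial left ideal of rank one *)

Section LocallyCyclic.
Variables (T : Type) (G : group T).
Hypothesis cG : locally_cyclic G.

Lemma locally_cyclic_comm : commutative (gop G).
Proof.
move=> x y; have [g xyg] := cG (finite_set2 x y).
have [gx gy] : generated G [set g] x /\ generated G [set g] y.
  by rewrite -xyg; split; apply: sub_generated; [left|right].
by apply: generated_abelian gx gy => _ _ -> ->.
Qed.

Lemma locally_cyclic_pair (hG : commutative (gop G)) : pair_cyclic (zmod_of hG).
Proof.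
move=> x y; have [g xyg] := cG (finite_set2 (x : T) y).
have gP : generated G [set g] `<=` [set z | exists i, z = (g : zmod_of hG) *~ i]%R.
  apply: generated_min => [|_ ->]; last by exists 1%R.
  exact: multiples_subgroup.
have [[i xi] [j yj]] : [set z | exists i, z = (g : zmod_of hG) *~ i]%R x /\
    [set z | exists i, z = (g : zmod_of hG) *~ i]%R y.
  by split; apply: gP; rewrite -xyg; apply: sub_generated; [left|right].
by exists g, i, j.
Qed.
End LocallyCyclic.

Section Subgroups.
Variables (T : Type) (G : group T) (S : set T) (hS : subgroup G S).

Lemma subg_torsion_free : torsion_free G -> torsion_free (subg hS).
Proof.
move=> tf x n n0 /(congr1 val); rewrite val_gpow => /(tf _ _ n0) xE.
exact: val_inj.
Qed.

Lemma subg_commensurable : commensurable G -> commensurable (subg hS).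
Proof.
move=> cG x y x1 y1.
have [a [b [a0 b0 E]]] : exists a b, [/\ (0 < a)%N, (0 < b)%N &
    gpow G (val x) a = gpow G (val y) b \/
    gop G (gpow G (val x) a) (gpow G (val y) b) = gid G].
  by apply: cG => e; [apply: x1|apply: y1]; apply: val_inj.
exists a, b; split=> //; rewrite -!(val_gpow hS) in E.
by case: E => E; [left|right]; apply: val_inj.
Qed.

Lemma subg_commutative : (forall x y, S x -> S y -> gop G x y = gop G y x) ->
  commutative (gop (subg hS)).
Proof. by move=> cS x y; apply: val_inj; apply: cS; apply: set_valP. Qed.
End Subgroups.

Lemma partial_morph_mulrz (U V : zmodType) (P : U -> Prop) (f : U -> V) (x : U) (n : int) :
  P 0%R -> (forall x y, P x -> P y -> P (x + y)%R) -> (forall x, P x -> P (- x)%R) ->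
  (forall x y, P x -> P y -> f (x + y) = f x + f y)%R ->
  P x -> (f (x *~ n) = f x *~ n)%R.
Proof.
move=> P0 PD PN fD Px.
have f0 : (f 0 = 0)%R by apply: (addrI (f 0%R)); rewrite -fD // !addr0.
have fN y : P y -> (f (- y) = - f y)%R.
  by move=> Py; apply: (addrI (f y)); rewrite -fD ?subrr //; apply: PN.
have Pn k : P (x *+ k)%R.
  by elim: k => [|k IHk]; rewrite ?mulr0n // mulrS; apply: PD.
have fn k : (f (x *+ k) = f x *+ k)%R.
  by elim: k => [|k IHk]; rewrite ?mulr0n // !mulrS fD // IHk.
case: (intP n) => [|k|k]; [by rewrite !mulr0z | exact: fn | ].
by rewrite !mulrNz fN; [congr (- _)%R; apply: fn | apply: Pn].
Qed.

Section SignAction.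
Variables (T : Type) (B : skewBrace T).
Hypotheses (mulC : commutative (gop (mulg B))) (mul_tf : torsion_free (mulg B)).
Hypothesis mul_cyc : pair_cyclic (zmod_of mulC).
Local Notation Z := (zmod_of mulC).
Local Notation lam := (lambda B).

Variable J : set T.
Hypotheses (J_sub : subgroup (addg B) J) (J_lam : forall b x, J x -> J (lam b x)).
Hypothesis J_triv : forall x y, J x -> J y -> x +[B] y = x o[B] y.
Hypothesis J_neq0 : exists2 x, J x & x <> 0[B].

Let J_mul : subgroup (mulg B) J.
Proof. by have [] := left_ideal_sub_brace J_sub J_lam. Qed.

(** Rank one makes the quotient by any non-zero subgroup a torsion group. *)
Lemma torsion_mod b : exists2 n, (0 < n)%N & J (gpow (mulg B) b n).
Proof.
have [x Jx x0] := J_neq0; have [g [i [j [gi gj]]]] := mul_cyc (x : Z) b.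
have i0 : i <> 0%R.
  by move=> i0; apply: x0; rewrite -mulg_id gi i0.
exists `|i|%N; first by lia.
rewrite (zmod_gpow (hG := mulC)) gj.
have -> : (g *~ j *+ `|i| = (x : Z) *~ (sgz i * j))%R.
  rewrite gi - [LHS]/(g *~ j *~ `|i|%N)%R -!mulrzA abszEsg; congr (_ *~ _)%R.
  by ring.
exact: (@subgroup_mulrz _ _ mulC).
Qed.

Let lam_mulrz b (x : Z) (n : int) : J x -> lam b (x *~ n)%R = ((lam b x : Z) *~ n)%R.
Proof.
case: J_mul => J0 JM JV.
apply: (@partial_morph_mulrz Z Z J (lam b)) => // u v Ju Jv.
rewrite - [RHS]/(lam b u o[B] lam b v) -J_triv; try exact: J_lam.
by rewrite -lambdaD J_triv.
Qed.

Let opp_inv x : J x -> -[B] x = ginv (mulg B) x.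
Proof.
move=> Jx; have [_ _ JV] := J_mul; symmetry; apply: ginv_unique.
by rewrite J_triv ?mulxV //; apply: JV.
Qed.

(** For x <> 0 in J there are non-zero m and l with m lambda_b(x) = l x.  As a power
    b^n lies in J and J acts trivially on itself, lambda_b^n = 1 on J, which
    gives m^n = l^n and l = m or l = - m.  Commensurability of the elements of J
    spreads the sign found at x to all of J. *)
Lemma sign_action b :
  (forall x, J x -> lam b x = x) \/ (forall x, J x -> lam b x = -[B] x).
Proof.
have [x Jx x0] := J_neq0.
have xN0 : (x : Z) <> 0%R by rewrite - [0%R]/(gid (mulg B)) mulg_id.
have [m [l [m0 l0 E]]] : exists m l : int,
    [/\ m <> 0, l <> 0 & (lam b x : Z) *~ m = (x : Z) *~ l]%R.
  apply: rank_one => // lx0; apply: xN0; rewrite -(lambdaK B b x) lx0.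
  by rewrite - [0%R]/(gid (mulg B)) mulg_id lambda0r.
have iterE k : ((iter k (lam b) x : Z) *~ (m ^+ k) = (x : Z) *~ (l ^+ k))%R.
  elim: k => [|k IHk]; first by [].
  have Jk : J (iter k (lam b) x) by elim: (k) => //= j; apply: J_lam.
  rewrite iterS exprSr mulrzA -lam_mulrz // IHk lam_mulrz // mulrzAC E.
  by rewrite -mulrzA -exprS.
have [n n0 Jn] := torsion_mod b.
have lm : `|l|%N = `|m|%N.
  have := iterE n; rewrite -iter_lambda.
  have -> : lam (gpow (mulg B) b n) x = x.
    by rewrite /lambda -J_triv // gmulVK.
  move=> /eqP; rewrite -subr_eq0 -mulrzBr => /eqP/(@zmod_tf _ _ mulC mul_tf x) xz.
  have /eqP : (m ^+ n - l ^+ n = 0)%R.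
    by apply: contra_notP xN0 => /xz.
  rewrite subr_eq0 => /eqP/(congr1 absz); rewrite !abszX => /eqP.
  by rewrite eqn_exp2r // => /eqP.
have xfix (s : int) : l = (s * m)%R -> lam b x = ((x : Z) *~ s)%R.
  move=> ls; move/eqP: E; rewrite ls mulrzA -subr_eq0 -mulrzBl => /eqP.
  by move=> /(@zmod_tf _ _ mulC mul_tf _ _ m0)/eqP; rewrite subr_eq0 => /eqP.
have spread (s : int) : l = (s * m)%R -> forall y, J y -> lam b y = ((y : Z) *~ s)%R.
  move=> ls y Jy; have [g [i [j [xi yj]]]] := mul_cyc (x : Z) y.
  have i0 : i <> 0%R by move=> i0; apply: xN0; rewrite xi i0 mulr0z.
  apply: (@subr0_eq Z); apply: (@zmod_tf _ _ mulC mul_tf _ _ i0).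
  rewrite mulrzBl -lam_mulrz //.
  have -> : ((y : Z) *~ i = (x : Z) *~ j)%R by rewrite xi yj -!mulrzA mulrC.
  rewrite lam_mulrz // (xfix s ls) xi yj -!mulrzA.
  by rewrite -mulrzBr (_ : (_ - _)%R = 0%R) ?mulr0z //; ring.
have [ls|ls] : (l = 1 * m)%R \/ (l = (-1) * m)%R by lia.
- by left => y Jy; rewrite (spread _ ls) ?mulr1z.
- by right => y Jy; rewrite (spread _ ls) // mulrN1z opp_inv.
Qed.
End SignAction.

(** * The trivial sub-skew brace of index two *)

Section Pointwise.
Variables (T : Type) (B : skewBrace T) (I : set T).

(** The pointwise stabilizer of I under the lambda action. *)
Definition lambda_centralizer : set T := [set b | forall x, I x -> lambda B b x = x].

Lemma lambda_centralizer_subgroup : subgroup (mulg B) lambda_centralizer.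
Proof.
split=> [x _|a b ca cb x Ix|a ca x Ix] /=; first by rewrite mulg_id lambda0l.
- by rewrite lambdaM cb // ca.
- by rewrite -{1}(ca x Ix) lambdaK.
Qed.
End Pointwise.

Lemma sign_square (T : Type) (B : skewBrace T) (J : set T) x :
  (forall y, J y -> lambda B x y = y) \/ (forall y, J y -> lambda B x y = -[B] y) ->
  lambda_centralizer B J (x o[B] x).
Proof.
by case=> h y Jy; rewrite lambdaM (h y Jy) ?lambdaN (h y Jy) ?ginvK.
Qed.

Section Structure.
Variables (T : Type) (B : skewBrace T).
Hypotheses (mulC : commutative (gop (mulg B))) (mul_tf : torsion_free (mulg B)).
Hypothesis mul_cyc : pair_cyclic (zmod_of mulC).
Hypothesis nontriv : ~ trivial_brace B.
Local Notation Z := (zmod_of mulC).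
Local Notation "x + y" := (gop (addg B) x y).
Local Notation "- x" := (ginv (addg B) x).
Local Notation "x - y" := (gop (addg B) x (ginv (addg B) y)).
Local Notation "0" := (gid (addg B)).
Local Notation "x ∘ y" := (gop (mulg B) x y) (at level 40, left associativity).
Local Notation "x ^-1" := (ginv (mulg B) x).
Local Notation lam := (lambda B).
Local Notation I := (star_square B).

Let I_sub : subgroup (addg B) I. Proof. exact: star_square_subgroup. Qed.

Lemma star_square_mulE x y : I x -> I y -> x + y = x ∘ y.
Proof.
move=> Ix Iy.
have hI := left_ideal_sub_brace I_sub (star_square_lambda mulC).
have tr : trivial_brace (sub_brace hI).
  apply: abelian_brace_trivial.
  - by apply: subg_commutative => u v Iu Iv; apply: (star_square_addC mulC).
  - by apply: subg_commutative => u v _ _; apply: mulC.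
  - exact: subg_torsion_free.
  - exact/subg_commensurable/(pair_cyclic_commensurable mul_cyc).
have := tr (SigSub (mem_set Ix)) (SigSub (mem_set Iy)).
by move=> /(congr1 val).
Qed.

Lemma star_square_neq0 : exists2 x, I x & x <> 0.
Proof.
apply: contra_notP nontriv => I0 a b.
have st0 : star B a b = 0.
  by apply: contra_notP I0 => st0; exists (star B a b) => //; apply: mem_star_square.
by rewrite mulE lambda_star st0 gop1x.
Qed.

(** The elements that act trivially on I through both lambda and lambda^op;
    equivalently, lambda_b fixes I and b centralizes I in (B, +). *)
Definition core : set T := lambda_centralizer B I `&` lambda_centralizer (opp_brace B) I.
Local Notation C := core.

Lemma coreP c : C c <-> (forall x, I x -> lam c x = x) /\ (forall x, I x -> c + x - c = x).
Proof.
split=> - [lc oc]; split=> // x Ix.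
- by have := oc x Ix; rewrite lambda_oppE lc.
- by rewrite lambda_oppE lc // oc.
Qed.

Lemma star_square_core : I `<=` C.
Proof.
move=> x Ix; apply/coreP; split=> y Iy.
- by rewrite /lambda -star_square_mulE // gmulVK.
- by rewrite (star_square_addC mulC Ix Iy) !gE.
Qed.

Lemma core_mul_subgroup : subgroup (mulg B) C.
Proof.
have [C0 CM CV] := lambda_centralizer_subgroup B I.
have [D0 DM DV] := lambda_centralizer_subgroup (opp_brace B) I.
by split=> [|x y [? ?] [? ?]|x [? ?]]; split; auto.
Qed.

(** B acts trivially on B / I, so lambda_b(c) lies in c o I, and I is contained
    in the core. *)
Lemma core_lambda b c : C c -> C (lam b c).
Proof.
move=> Cc; rewrite lambda_star.
have -> : star B b c + c = c ∘ lam c^-1 (- c + star B b c - (- c)).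
  by rewrite -addE !gE.
have [_ CM _] := core_mul_subgroup; apply: CM => //; apply: star_square_core.
by have /(star_square_conj (- c))/(star_square_lambda mulC c^-1) := mem_star_square B b c.
Qed.

Lemma core_add_subgroup : subgroup (addg B) C.
Proof.
have [C0 CM CV] := core_mul_subgroup; split=> [|x y Cx Cy|x Cx].
- by rewrite -mulg_id.
- by rewrite addE; apply/CM/core_lambda.
- by rewrite oppE; apply/core_lambda/CV.
Qed.

(** Modulo I the two operations agree and o is commutative. *)
Lemma star_square_comm b c : I (b + c - b - c).
Proof.
have [I0 ID IN] := I_sub.
have conj := star_square_conj.
have -> : b + c - b - c =
    - (b + star B b c - b) + (c + star B c b - c).
  have : b + star B b c + c = c + star B c b + b.
    by rewrite (gassoc (addg B) b) (gassoc (addg B) c) -!lambda_star -!mulE mulC.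
  move: (star B b c) (star B c b) => s t e; apply: (@gmulI _ (addg B) (b + s - b)).
  rewrite gmulKV; transitivity (b + s + c - b - c); first by rewrite !gE.
  by rewrite e !gE.
by apply: ID; [apply: IN|]; apply: conj; exact: mem_star_square.
Qed.

Lemma core_conj b c : C c -> C (b + c - b).
Proof.
move=> Cc; have [_ CD _] := core_add_subgroup.
have -> : b + c - b = b + c - b - c + c by rewrite !gE.
by apply: CD => //; apply: star_square_core; apply: star_square_comm.
Qed.

(** Put i = b * c, an element of I.  As b fixes I, lambda_b^n(c) = n i + c.  Choose n > 0
    with b^n in I; elements of I lie in the kernel of the action on the core,
    so n i = 0 and i = 0. *)
Lemma core_trivial b c : C b -> C c -> b + c = b ∘ c.
Proof.
move=> Cb Cc; set i := star B b c; have Ii : I i by apply: mem_star_square.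
have [Cb1 Cb2] := (coreP b).1 Cb; have [Cc1 Cc2] := (coreP c).1 Cc.
have [I0 ID IN] := I_sub.
have Ini n : I (gpow (addg B) i n) by elim: n => //= n; apply: ID.
have iterE n : iter n (lam b) c = gpow (addg B) i n + c.
  elim: n => [|n IHn]; first by rewrite gop1x.
  rewrite iterS IHn lambdaD Cb1 // lambda_star -/i gopA.
  by rewrite (star_square_addC mulC (Ini n) Ii).
have [n n0 In] := torsion_mod mul_cyc I_sub (star_square_lambda mulC) star_square_neq0 b.
have i0 : gpow (addg B) i n = 0.
  apply: (@gmulIr _ (addg B) c); rewrite -iterE -iter_lambda gop1x.
  rewrite /lambda mulC mulE Cc1 //; move: (gpow _ b n) In => j Ij.
  have -> : c + j = j + c by apply: (@gmulIr _ (addg B) (- c)); rewrite Cc2 // !gE.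
  by rewrite gmulVK.
have powE k : gpow (addg B) i k = gpow (mulg B) i k.
  elim: k => [|k IHk] /=; first by rewrite mulg_id.
  by rewrite star_square_mulE // IHk.
rewrite mulE lambda_star -/i (mul_tf n0 (_ : gpow (mulg B) i n = _)); last first.
  by rewrite -powE i0 mulg_id.
by rewrite mulg_id gop1x.
Qed.


Lemma core_sub_brace : sub_skew_brace B C.
Proof. exact: left_ideal_sub_brace core_add_subgroup core_lambda. Qed.

Lemma core_normal : normal (addg B) C.
Proof. by split=> [|g x]; [exact: core_add_subgroup | exact: core_conj]. Qed.

Lemma core_addC x y : C x -> C y -> x + y = y + x.
Proof. by move=> Cx Cy; rewrite !core_trivial // mulC. Qed.

Lemma core_sign b : (forall x, C x -> lam b x = x) \/ (forall x, C x -> lam b x = - x).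
Proof.
have [x Ix x0] := star_square_neq0.
apply: (sign_action mul_tf mul_cyc core_add_subgroup core_lambda core_trivial).
by exists x => //; apply: star_square_core.
Qed.

Let oppC_sub : subgroup (addg (opp_brace B)) C.
Proof.
have [C0 CD CN] := core_add_subgroup.
by split=> // x y Cx Cy; apply: CD.
Qed.

Lemma core_opp_sign b : (forall x, C x -> lambda (opp_brace B) b x = x) \/
  (forall x, C x -> lambda (opp_brace B) b x = - x).
Proof.
have [x Ix x0] := star_square_neq0.
apply: (sign_action (B := opp_brace B) mul_tf mul_cyc oppC_sub).
- by move=> u y Cy; rewrite lambda_oppE; apply/core_conj/core_lambda.
- by move=> u y Cu Cy; rewrite -core_trivial // core_addC.
- by exists x => //; apply: star_square_core.
Qed.

(** The square of a sign is +1. *)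
Lemma core_square x : C (x ∘ x).
Proof.
split; apply: sign_square.
- by case: (core_sign x) => h; [left|right] => y /star_square_core; apply: h.
- by case: (core_opp_sign x) => h; [left|right] => y /star_square_core; apply: h.
Qed.

Lemma noncore_nonempty : exists a, ~ C a.
Proof.
apply: contra_notP nontriv => nC a b.
by apply: core_trivial; apply: contra_notP nC => nC; [exists a | exists b].
Qed.

Lemma noncore_mul x y : ~ C x -> ~ C y -> C (x ∘ y).
Proof.
move=> nx ny; have [||z xy] := @nondoubles_sum_double Z mul_cyc x y.
- by case=> z xz; apply: nx; rewrite xz; apply: core_square.
- by case=> z yz; apply: ny; rewrite yz; apply: core_square.
- by rewrite [x ∘ y]xy; apply: core_square.
Qed.

(** If neither c nor a, an element outside the core, were a square, c o a would
    be one and so lie in the core, and with it a. *)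
Lemma core_is_square c : C c -> exists y, c = y ∘ y.
Proof.
move=> Cc; have [a na] := noncore_nonempty.
apply: contra_notP na => nc.
have [C0 CM CV] := core_mul_subgroup.
have [[z ->]|na] := pselect (exists z, a = z ∘ z); first exact: core_square.
have [z ca] := @nondoubles_sum_double Z mul_cyc c a nc na.
have -> : a = c^-1 ∘ (z ∘ z) by rewrite - [z ∘ z]ca gmulVK.
by apply: CM; [apply: CV | apply: core_square].
Qed.

Lemma mul_square_inj x y : x ∘ x = y ∘ y -> x = y.
Proof.
move=> xy; apply: (@subr0_eq Z); apply: (@zmod_tf _ _ mulC mul_tf _ 2%:Z) => //.
rewrite mulrzBl; change ((x ∘ x : Z) - (y ∘ y : Z) = 0 :> Z)%R; by rewrite xy subrr.
Qed.

Lemma core_double_eq0 c : C c -> c + c = 0 -> c = 0.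
Proof.
by move=> Cc c2; apply: mul_square_inj; rewrite mulx0 -core_trivial.
Qed.

Lemma core_opp c : C c -> - c = c^-1.
Proof.
move=> Cc; symmetry; apply: ginv_unique; rewrite core_trivial ?mulxV //.
by have [_ _] := core_mul_subgroup; apply.
Qed.

Lemma noncore_inv x : ~ C x -> ~ C x^-1.
Proof. by move=> nx; have [_ _ CV] := core_mul_subgroup => /CV; rewrite ginvK. Qed.

Lemma noncore_opp x : ~ C x -> ~ C (- x).
Proof. by move=> nx; have [_ _ CV] := core_add_subgroup => /CV; rewrite ginvK. Qed.

Lemma noncore_add x y : ~ C x -> ~ C y -> C (x + y).
Proof.
move=> nx ny; rewrite addE; apply: noncore_mul => //.
by move=> /(core_lambda x); rewrite lambdaVK.
Qed.

Lemma noncore_neq0 x : ~ C x -> x <> 0.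
Proof. by move=> nx x0; apply: nx; rewrite x0; case: core_add_subgroup. Qed.

(** The signs of lambda_x and lambda^op_x on the core cannot both be -1.  Otherwise x
    commutes with the core in (B, +), and c = x o x and d = x + x lie in the core;
    from lambda_x(x) = - x + c we get lambda_x(d) = - d + 2 c, while lambda_x(d) = - d.
    So c = 0. *)
Lemma noncore_sign x : ~ C x ->
  (forall c, C c -> x + c - x = - c) /\
  ((forall c, C c -> lam x c = - c) \/ (forall c, C c -> lam x c = c)).
Proof.
move=> nx; have [_ CD CN] := core_add_subgroup.
have [l1|lN] := core_sign x; have [o1|oN] := core_opp_sign x.
- case: nx; split=> y /star_square_core Cy; [exact: l1 | exact: o1].
- by split=> [c Cc|]; [have := oN c Cc; rewrite lambda_oppE l1 | right].
- split=> [c Cc|]; last by left.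
  by have := o1 _ (CN _ Cc); rewrite lambda_oppE lambdaN lN // ginvK.
- have conj c : C c -> c + x = x + c.
    move=> Cc; have := oN _ (CN _ Cc); rewrite lambda_oppE lambdaN lN // !ginvK => e.
    by apply: (@gmulIr _ (addg B) (- x)); rewrite e !gE.
  have C2 := core_square x; have Cd := noncore_add nx nx.
  case: (noncore_neq0 nx); apply: mul_square_inj; rewrite mulx0.
  apply: core_double_eq0 => //.
  have lx : lam x x = - x + x ∘ x by [].
  have := lN _ Cd; rewrite lambdaD lx; move: (x ∘ x) C2 => c Cc e.
  apply: (@gmulI _ (addg B) (- (x + x))); rewrite gopx1; apply: etrans e.
  have xc : - x + c = c - x.
    by apply: (@gmulI _ (addg B) x); rewrite gmulKV gopA -conj // !gE.
  by rewrite !gassoc (gopA (addg B) c) -xc !gE.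
Qed.

Lemma noncore_conj x c : ~ C x -> C c -> x + c - x = - c.
Proof. by move=> /noncore_sign[h _]; apply: h. Qed.

(** x + x commutes with x and is inverted by it. *)
Lemma noncore_double x : ~ C x -> x + x = 0.
Proof.
move=> nx; have Cd := noncore_add nx nx; apply: core_double_eq0 => //.
have e : - (x + x) = x + x by rewrite -(noncore_conj nx Cd) !gE.
by rewrite -{2}e gopxV.
Qed.

Lemma noncore_oppE x : ~ C x -> - x = x.
Proof. by move=> nx; symmetry; apply/ginv_unique/noncore_double. Qed.

Lemma noncore_lambda a x c : ~ C a -> ~ C x -> C c -> lam x c = lam a c.
Proof.
move=> na nx Cc; have -> : x = (x ∘ a^-1) ∘ a by rewrite !gE.
have Cu := noncore_mul nx (noncore_inv na).
rewrite lambdaM; move: (lam a c) (core_lambda a Cc) => v Cv.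
by rewrite /lambda -(core_trivial Cu Cv) gmulVK.
Qed.


(** Squaring is an isomorphism from (B, o) onto the core. *)
Lemma core_isomorphic (hC : sub_skew_brace B C) :
  isomorphic (addg (sub_brace hC)) (mulg B).
Proof.
have sq (c : C) : exists y, val c = y ∘ y.
  by apply: core_is_square; apply: set_valP.
pose f (c : C) : T := projT1 (cid (sq c)).
have fE c : val c = f c ∘ f c by rewrite /f; case: cid.
exists f; split; last first.
  move=> x y /=; apply: mul_square_inj; rewrite -fE.
  transitivity (val x ∘ val y); first by rewrite -core_trivial //; exact: set_valP.
  rewrite !fE; move: (f x) (f y) => u v.
  by rewrite !gassoc; congr (_ ∘ _); rewrite mulC gassoc (mulC u).
exists (fun y => SigSub (mem_set (core_square y))) => [c|y].
- by apply: val_inj; rewrite /= -fE.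
- by apply: mul_square_inj; rewrite -fE.
Qed.

Lemma core_not_two_divisible (hC : sub_skew_brace B C) :
  ~ two_divisible (addg (sub_brace hC)).
Proof.
have [a na] := noncore_nonempty.
move=> /(_ (SigSub (mem_set (core_square a))))[y] /(congr1 val) /=.
have Cy : C (val y) by apply: set_valP.
by rewrite core_trivial // => /mul_square_inj aE; apply: na; rewrite aE.
Qed.

Lemma core_trivial_brace (hC : sub_skew_brace B C) : trivial_brace (sub_brace hC).
Proof. by move=> x y; apply: val_inj; apply: core_trivial; apply: set_valP. Qed.

Lemma noncore_generated a : ~ C a -> generated (addg B) [set a] = [set 0; a].
Proof.
move=> na; apply/seteqP; split.
- apply: generated_min => [|_ ->]; last by right.
  split=> [|x y|x]; first by left.
  + by move=> [->|->] [->|->]; rewrite ?gop1x ?gopx1 ?noncore_double //; [left|right|right|left].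
  + by move=> [->|->]; rewrite ?ginv1 ?noncore_oppE //; [left|right].
- have [g0 _ _] := generated_subgroup (addg B) [set a].
  by move=> _ [->|->] //; apply: sub_generated.
Qed.

Lemma core_semidirect a : ~ C a ->
  semidirect (addg B) C (generated (addg B) [set a]).
Proof.
move=> na; have [C0 CD CN] := core_add_subgroup; split.
- exact: core_normal.
- exact: generated_subgroup.
- rewrite noncore_generated //; apply/seteqP; split=> [x [Cx [//|xa]]|_ ->].
    by case: na; rewrite -xa.
  by split; [|left].
- move=> g; rewrite noncore_generated //; have [Cg|ng] := pselect (C g).
    by exists g, 0; split; [|left|rewrite gopx1].
  exists (g - a), a; split; [|by right|by rewrite !gE].
  by apply: noncore_add => //; apply: noncore_opp.
Qed.

Lemma noncore_order a : ~ C a -> has_order (addg B) a 2.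
Proof.
move=> na; split=> //=; first by rewrite gopx1 noncore_double.
case=> [//|[|//]] _ /=; rewrite gopx1; exact: noncore_neq0.
Qed.

(** Let a lie outside the core, c = a o a and b = a o a o a.  The powers of b form the
    set P = E u (b + E), where E consists of the multiples of b o b = 3 c; so P is a
    sub-skew brace.  If it were normal in (B, +), then c + b - c = b - 2 c would
    lie in P, that is, 2 c would be a multiple of 3 c.  The cube is needed because
    the powers of a itself may exhaust B. *)
Lemma not_dedekind : ~ dedekind B.
Proof.
have [a na] := noncore_nonempty.
have [C1 CM CV] := core_mul_subgroup; have [C0 CD CN] := core_add_subgroup.
have Csq := core_square.
pose b : Z := a ∘ (a ∘ a).
have nb : ~ C b.
  move=> Cb; apply: na; have -> : a = b ∘ (a ∘ a)^-1 by rewrite /b !gE.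
  by apply: CM => //; apply: CV.
pose P := [set x : T | exists i : int, x = (b *~ i)%R].
pose E := [set x : T | exists i : int, x = ((b ∘ b : Z) *~ i)%R].
have [P0 PM PV] := multiples_subgroup (hG := mulC) b.
have [E0 EM EV] := multiples_subgroup (hG := mulC) (b ∘ b).
have EC : E `<=` C by move=> _ [i ->]; apply: subgroup_mulrz => //; apply: core_square.
have ED x y : E x -> E y -> E (x + y).
  by move=> Ex Ey; rewrite core_trivial; [apply: EM | apply: EC | apply: EC].
have EN x : E x -> E (- x).
  by move=> Ex; rewrite core_opp; [apply: EV | apply: EC].
have Elam y x : E x -> E (lam y x).
  by case: (core_sign y) => h Ex; rewrite h; [| apply: EC | apply: EN | apply: EC].
have bb := noncore_double nb; have bN := noncore_oppE nb.
have bK x : b + (b + x) = x by rewrite gopA bb gop1x.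
have bconj u : E u -> b + u + b = - u.
  by move=> /EC Cu; rewrite -{2}bN noncore_conj.
have bdouble (k : int) : ((b ∘ b : Z) *~ k = b *~ (2 * k))%R by rewrite mulrzA.
have PE x : P x <-> E x \/ E (b + x).
  split=> [[i ->]|[[i ->]|Ebx]].
  (* Odd powers: b o u = b + lambda_b(u), and adding b on the left cancels b. *)
  - have [k [ik|ik]] : exists k : int, i = (2 * k)%R \/ i = (1 + 2 * k)%R.
      exists (i %/ 2)%Z; have := divz_eq i 2; have := modz_ge0 i (isT : 2 != 0 :> int)%R.
      by have := ltz_pmod i (isT : 0 < 2 :> int)%R; lia.
    + by left; exists k; rewrite bdouble ik.
    + right; have -> : (b *~ i)%R = b ∘ ((b ∘ b : Z) *~ k)%R.
        by rewrite bdouble ik mulrzDr mulr1z.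
      by rewrite mulE bK; apply: Elam; exists k.
  - by exists (2 * i)%R; rewrite bdouble.
  - have -> : x = b ∘ lam b^-1 (b + x) by rewrite -addE bK.
    have [k ->] := Elam b^-1 _ Ebx.
    by exists (1 + 2 * k)%R; rewrite bdouble mulrzDr mulr1z.
have Padd : subgroup (addg B) P.
  split=> [|x y /PE Px /PE Py|x /PE Px]; apply/PE.
  - by left; rewrite -(mulg_id B).
  - case: Px Py => Ex [] Ey.
    + by left; apply: ED.
    + right; have -> : b + (x + y) = (b + x + b) + (b + y) by rewrite !gassoc bK.
      by apply: ED => //; rewrite bconj //; apply: EN.
    + by right; rewrite gopA; apply: ED.
    + left; have -> : x + y = (b + (b + x) + b) + (b + y) by rewrite bK !gassoc bK.
      by apply: ED => //; rewrite bconj //; apply: EN.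
  - case: Px => Ex; [by left; apply: EN | right].
    have -> : b - x = - (x + b) by rewrite ginvM bN.
    by rewrite - [x in x + b]bK bconj // ginvK.
move=> /(_ P (conj Padd (And3 P0 PM PV)))[[_ Pconj] _ _].
have Cc := core_square a; set c := a ∘ a in Cc.
have Pb : P b by exists 1%R.
have nx : ~ C (c + b - c).
  move=> Cx; apply: nb; have -> : b = - c + (c + b - c) + c by rewrite !gE.
  by apply: (CD) => //; apply: CD => //; apply: CN.
case: ((PE _).1 (Pconj c b Pb)) => [/EC//|[i]].
have -> : b + (c + b - c) = - c - c.
  transitivity (b + c - b - c); first by rewrite bN !gassoc.
  by rewrite noncore_conj.
rewrite core_opp // core_trivial ?bdouble; try exact: CV.
move=> e.
have: ((a : Z) *~ (4 + 6 * i) = 0)%R.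
  rewrite mulrzDr; apply/eqP; rewrite addrC addr_eq0; apply/eqP.
  transitivity (b *~ (2 * i))%R.
    by rewrite - [6%R]/(3 * 2 :> int)%R -mulrA (mulrzA _ 3).
  rewrite -e.
  have cE : c = ((a : Z) *~ 2)%R by [].
  change ((- (c : Z) - (c : Z)) = - ((a : Z) *~ 4))%R.
  by rewrite cE -opprD -mulrzDr.
move=> /(@zmod_tf _ _ mulC mul_tf a) a0; apply: (noncore_neq0 na).
by rewrite a0 ?mulg_id //; [exact: mulg_id | lia].
Qed.

End Structure.

(** The two signs of lambda on the complement of the core give the two cases. *)
Lemma skew_brace_structure (T : Type) (B : skewBrace T) :
     ~ trivial_brace B ->
     torsion_free (mulg B) -> locally_cyclic (mulg B) ->
     exists (C : set T) (hC : sub_skew_brace B C) (a : T),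
       [/\ semidirect (addg B) C (generated (addg B) [set a]),
           trivial_brace (sub_brace hC) /\
             isomorphic (addg (sub_brace hC)) (mulg B),
           has_order (addg B) a 2 /\
             (forall c, C c -> a +[B] c +[B] -[B] a = -[B] c),
           ~ dedekind B /\ ~ two_divisible (addg (sub_brace hC)) &
           [/\ ker_lambda B = C,
               forall b, C b -> lambda B a b = -[B] b &
               lambda B a a = a +[B] (a o[B] a)]
           \/
           [/\ ker_lambda B = [set 0[B]],
               star_set B setT C = [set 0[B]] &
               forall b, C b -> a o[B] b = a +[B] b]].
Proof.
move=> nontriv tf lc.
have mulC := locally_cyclic_comm lc.
have cyc := locally_cyclic_pair lc (hG := mulC).
have hC := core_sub_brace tf cyc.
have [a na] := noncore_nonempty tf cyc nontriv.
exists (core B), hC, a; split.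
- exact: (core_semidirect tf cyc nontriv).
- split; first exact: (core_trivial_brace tf cyc nontriv).
  exact: (core_isomorphic tf cyc nontriv).
- split; first exact: (noncore_order tf cyc nontriv).
  by move=> c; apply: (noncore_conj tf cyc nontriv).
- split; first exact: (not_dedekind tf cyc nontriv).
  exact: (core_not_two_divisible tf cyc nontriv).
have Csq := core_square tf cyc nontriv.
have Ctriv := core_trivial tf cyc nontriv.
have [C0 CD CN] := core_add_subgroup tf cyc.
have nlam x c : ~ core B x -> core B c -> lambda B x c = lambda B a c.
  exact: (noncore_lambda tf cyc nontriv).
have nconj x c : ~ core B x -> core B c -> x +[B] c +[B] -[B] x = -[B] c.
  exact: (noncore_conj tf cyc nontriv).
have ndouble x : ~ core B x -> x +[B] x = 0[B].
  exact: (noncore_double tf cyc nontriv).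
have nopp x : ~ core B x -> -[B] x = x.
  exact: (noncore_oppE tf cyc nontriv).
have sq_neq0 x : x o[B] x = 0[B] -> x = 0[B].
  by move=> xx; apply: (mul_square_inj mulC tf); rewrite mulx0.
have clam c x : core B c -> core B x -> lambda B c x = x.
  by move=> Cc Cx; rewrite /lambda -Ctriv // gmulVK.
have lam_swap c x : lambda B c x = -[B] c +[B] (x +[B] lambda B x c).
  by rewrite -mulE mulC.
have addx c x : ~ core B x -> core B c -> x +[B] c = -[B] c +[B] x.
  by move=> nx Cc; rewrite -(nconj x) // !gE.
have [_ [lN|l1]] := noncore_sign tf cyc nontriv na; [left|right].
- split=> //; last by rewrite {1}/lambda nopp.
  apply/seteqP; split=> [x xk|c Cc x].
    apply: contrapT => nx; apply: na.
    suff -> : a = 0[B] by [].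
    apply/sq_neq0/(core_double_eq0 tf cyc nontriv) => //.
    have := xk (a o[B] a); rewrite nlam // lN // => e.
    by rewrite -{1}e gopVx.
  have [Cx|nx] := pselect (core B x); first exact: clam.
  by rewrite lam_swap nlam // lN // (addx _ _ nx (CN _ Cc)) gmulKV.
- split.
  + apply/seteqP; split=> [x xk|_ -> b]; last exact: lambda0l.
    have [Cx|nx] := pselect (core B x).
      apply: (core_double_eq0 tf cyc nontriv) => //.
      have := xk a; rewrite lam_swap l1 // (addx _ _ na Cx) => e.
      rewrite -(ginvK (addg B) (x +[B] x)) ginvM - [RHS](ginv1 (addg B)); congr (ginv _ _).
      by apply: (@gmulIr _ (addg B) a); rewrite gassoc e gop1x.
    apply: sq_neq0; have := xk x; rewrite /lambda => e.
    by rewrite -(gmulKV (addg B) x (x o[B] x)) e; apply: ndouble.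
  + apply/seteqP; split; last by move=> _ ->; have [] := generated_subgroup (addg B)
      [set z | exists x y, [/\ setT x, core B y & z = star B x y]].
    apply: generated_min => [|_ [x [c [_ Cc ->]]]].
      split=> // [_ _ -> ->|_ ->] /=; by rewrite ?gop1x ?ginv1.
    have lx : lambda B x c = c.
      by have [Cx|nx] := pselect (core B x); [exact: clam | rewrite nlam // l1].
    by rewrite /star -/(lambda B x c) lx gopxV.
  + by move=> c Cc; rewrite mulE l1.
Qed.

(** * Twisting an abelian group by a sign character *)

Section Twist.
Variables (T : Type) (M : group T) (mulC : commutative (gop M)).
Local Notation Z := (zmod_of mulC).
Local Open Scope ring_scope.
Variable s : Z -> int.
Hypotheses (s_sqr : forall x, s x * s x = 1) (sD : forall x y, s (x + y) = s x * s y).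

Let s0 : s 0 = 1.
Proof. by have := sD 0 0; rewrite addr0 s_sqr. Qed.

Let sN x : s (- x) = s x.
Proof.
have := sD x (- x); rewrite subrr s0 => e.
by rewrite - [RHS]mulr1 e mulrA s_sqr mul1r.
Qed.

Let s_pm x : s x = 1 \/ s x = -1.
Proof. by have := s_sqr x; nia. Qed.

Let s_mulz x y : s (x *~ s y) = s x.
Proof. by case: (s_pm y) => ->; rewrite ?mulrN1z ?mulr1z ?sN. Qed.

(** The addition of Z is the given operation o, so this is y o z^s(y). *)
Definition twist_op (y z : Z) : Z := y + z *~ s y.
Definition twist_inv (y : Z) : Z := - (y *~ s y).

Let s_op y z : s (twist_op y z) = s y * s z.
Proof. by rewrite sD s_mulz. Qed.

Let s_inv y : s (twist_inv y) = s y.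
Proof. by rewrite sN s_mulz. Qed.

Let opA : associative twist_op.
Proof.
move=> x y z; rewrite {1 3}/twist_op s_op /twist_op mulrzDl addrA.
by rewrite -mulrzA mulrC.
Qed.

Let op0z : left_id 0 twist_op.
Proof. by move=> x; rewrite /twist_op s0 mulr1z add0r. Qed.
Let opz0 : right_id 0 twist_op.
Proof. by move=> x; rewrite /twist_op mul0rz addr0. Qed.
Let opNz : left_inverse 0 twist_inv twist_op.
Proof. by move=> x; rewrite /twist_op s_inv addNr. Qed.
Let opzN : right_inverse 0 twist_inv twist_op.
Proof. by move=> x; rewrite /twist_op /twist_inv mulNrz -mulrzA s_sqr mulr1z subrr. Qed.

Definition twist : group T := Defs.Group opA op0z opz0 opNz opzN.

Lemma twist_brace : brace_law twist M.
Proof.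
move=> a b c.
change ((a : Z) + twist_op b c =
  twist_op (twist_op ((a : Z) + (b : Z)) (twist_inv a)) ((a : Z) + (c : Z))).
rewrite {2}/twist_op s_op s_inv sD {2}/twist_op sD /twist_op /twist_inv.
rewrite mulNrz -mulrzA mulrA s_sqr mul1r [s a * _ * _]mulrAC s_sqr mul1r mulrzDl.
by rewrite !addrA subrK.
Qed.

Lemma twist_lambda a b : lambda (SkewBrace twist_brace) a b = (b : Z) *~ s a.
Proof.
change (twist_op (twist_inv a) ((a : Z) + (b : Z)) = (b : Z) *~ s a).
by rewrite /twist_op s_inv mulrzDl addKr.
Qed.

Lemma twist_opp_lambda a b :
  lambda (opp_brace (SkewBrace twist_brace)) a b = (a : Z) + b - (a : Z) *~ s b.
Proof.
change (twist_op ((a : Z) + (b : Z)) (twist_inv a) = (a : Z) + b - (a : Z) *~ s b).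
by rewrite /twist_op /twist_inv sD mulNrz -mulrzA mulrA s_sqr mul1r.
Qed.
End Twist.

Section RulesOpp.
Variables (T : Type) (M A : group T) (x : T).
Hypotheses (mulC : commutative (gop M)) (rA : rules1 M x A).

(** From x + x = 0 and x + d + x = - d one gets d + x = x - d, which turns the rule
    for x - d into the rule for x + d of the opposite group. *)
Lemma rules1_oppg : rules2 M x (oppg A).
Proof.
have [xx sq xd xdx] := rA.
have S1 : squares M (gid M) by exists (gid M); rewrite gop1x.
have e1 : gid M = gid A.
  by apply: (@gmulI _ A (gid M)); rewrite gopx1 sq // gop1x.
split=> //= [b d Sb Sd|d Sd|d Sd].
- by rewrite sq // mulC.
- rewrite -xd //; apply: (@gmulI _ A x); rewrite !gopA xx e1 gop1x.
  by have [-> ->] := xdx d Sd.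
- by rewrite gopA; apply: xdx.
Qed.
End RulesOpp.

Section Uniqueness.
Variables (T : Type) (M : group T) (mulC : commutative (gop M)).
Local Notation Z := (zmod_of mulC).
Hypothesis cyc : pair_cyclic Z.
Variables (x : T) (nx : ~ squares M x).

Definition square_sign (z : Z) : int := if `[< squares M z >] then 1%R else (-1)%R.

Lemma square_signT z : squares M z -> square_sign z = 1%R.
Proof. by move=> /asboolP; rewrite /square_sign => ->. Qed.

Lemma square_signF z : ~ squares M z -> square_sign z = (-1)%R.
Proof. by rewrite /square_sign; case: asboolP. Qed.

Lemma squaresM y z : squares M y -> squares M z -> squares M (gop M y z).
Proof.
move=> [u ->] [v ->]; exists (gop M u v).
by rewrite !gassoc; congr gop; rewrite mulC gassoc (mulC u).
Qed.

Lemma squaresV y : squares M y -> squares M (ginv M y).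
Proof. by move=> [u ->]; exists (ginv M u); rewrite ginvM. Qed.

Lemma nonsquaresM y z : ~ squares M y -> ~ squares M z -> squares M (gop M y z).
Proof. exact: (@nondoubles_sum_double Z cyc). Qed.

Lemma square_sign_sqr z : (square_sign z * square_sign z = 1)%R.
Proof. by rewrite /square_sign; case: ifP. Qed.

Lemma square_signM (y z : Z) :
  square_sign (y + z)%R = (square_sign y * square_sign z)%R.
Proof.
change (square_sign (gop M y z) = (square_sign y * square_sign z)%R).
have [Sy|nSy] := pselect (squares M y); have [Sz|nSz] := pselect (squares M z).
- by rewrite !square_signT //; apply: squaresM.
- rewrite (square_signT Sy) (square_signF nSz) square_signF // => Syz; apply: nSz.
  by rewrite -(gmulVK M y z); apply: squaresM => //; apply: squaresV.
- rewrite (square_signT Sz) (square_signF nSy) square_signF // => Syz; apply: nSy.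
  have -> : y = gop M (gop M y z) (ginv M z) by rewrite !gE.
  by apply: squaresM => //; apply: squaresV.
- by rewrite (square_signF nSy) (square_signF nSz) square_signT //; apply: nonsquaresM.
Qed.

Definition sign_twist : group T := twist square_sign_sqr square_signM.

Lemma sign_twist_rules1 : rules1 M x sign_twist.
Proof.
have sx := square_signF nx.
split=> [|b d Sb Sd|d Sd|d Sd] /=; rewrite /twist_op /twist_inv ?sx.
- by rewrite mulrN1z subrr.
- by rewrite square_signT.
- by rewrite square_signT // mulr1z mulrN1z opprK.
- rewrite square_signM sx square_signT; last first.
    by rewrite mulrN1z; apply: squaresV.
  rewrite mulr1 !mulrN1z (square_signT Sd) mulr1z; split=> //.
  by rewrite addrAC subrr add0r.
Qed.

(** Every non-square is x + c for a square c, and c + x = x - c moves all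
    occurrences of x to the left. *)
Lemma rules2_op A : rules2 M x A -> gop A = gop (oppg sign_twist).
Proof.
move=> [xx sq xd xdx]; apply/funext => y; apply/funext => z.
have S1 : squares M (gid M) by exists (gid M); rewrite gop1x.
have e1 : gid M = gid A.
  by apply: (@gmulI _ A (gid M)); rewrite gopx1 sq // gop1x.
have xK u : gop A x (gop A x u) = u by rewrite gopA xx e1 gop1x.
have coset u : ~ squares M u -> exists2 c, squares M c & u = gop A x c.
  move=> nu; have Sc : squares M (gop M (ginv M x) u).
    apply: nonsquaresM => // /squaresV; by rewrite ginvK.
  by exists (gop M (ginv M x) u) => //; rewrite xd // gmulKV.
have sqx u : squares M u -> gop A u x = gop A x (ginv M u).
  by move=> Su; rewrite -(xdx u Su).1 -!gopA xK.
change (gop A y z = (z : Z) + (y : Z) *~ square_sign z)%R.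
have [Sz|nSz] := pselect (squares M z).
  rewrite square_signT // mulr1z; change (gop A y z = gop M z y); rewrite mulC.
  have [Sy|nSy] := pselect (squares M y); first exact: sq.
  have [c Sc ->] := coset y nSy.
  rewrite gassoc (sq c z) // !xd ?gassoc //; exact: squaresM.
rewrite square_signF // mulrN1z; change (gop A y z = gop M z (ginv M y)).
have [c Sc ->] := coset z nSz.
have [Sy|nSy] := pselect (squares M y).
  rewrite gopA sqx // gassoc (sq (ginv M y)) //; last exact: squaresV.
  rewrite !xd //; last by apply: squaresM => //; apply: squaresV.
  by rewrite (mulC (ginv M y)) gopA.
have [c' Sc' ->] := coset y nSy.
rewrite gopA (xdx c' Sc').1 sq //; last exact: squaresV.
by rewrite !xd // ginvM gopA (mulC _ (ginv M c')) (mulC x) !gE.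
Qed.

Lemma rules2_unique : unique (rules2 M x) (oppg sign_twist).
Proof.
split=> [|A /rules2_op e]; last by apply: group_eq; rewrite e.
exact: (rules1_oppg mulC sign_twist_rules1).
Qed.

Lemma rules1_unique : unique (rules1 M x) sign_twist.
Proof.
split=> [|A /(rules1_oppg mulC)/rules2_op e]; first exact: sign_twist_rules1.
apply: group_eq; apply/funext => y; apply/funext => z.
exact: esym (congr1 (fun f => f z y) e).
Qed.

Hypothesis tf : torsion_free M.

Let double_eq0 (z : Z) : (z + z = 0)%R -> z = 0%R.
Proof. by move=> zz; apply: (@zmod_tf _ _ mulC tf _ 2%:Z). Qed.

Lemma sign_twist_ker :
  ker_lambda (SkewBrace (twist_brace square_sign_sqr square_signM)) = squares M.
Proof.
apply/seteqP; split=> [a ka|a Sa b]; last by rewrite twist_lambda square_signT.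
apply: contrapT => na; apply: nx.
have x0 : x = gid M.
  apply: double_eq0; have := ka x; rewrite twist_lambda square_signF // mulrN1z => e.
  by rewrite -{1}e addNr.
by rewrite x0; exists (gid M); rewrite gop1x.
Qed.

Lemma sign_twist_opp_ker :
  ker_lambda (opp_brace (SkewBrace (twist_brace square_sign_sqr square_signM)))
    = [set gid M].
Proof.
apply/seteqP; split=> [a ka|_ -> b].
  have := ka x; rewrite twist_opp_lambda square_signF // mulrN1z opprK => e.
  apply: double_eq0; apply: (@addrI Z x).
  by rewrite addr0 addrCA addrA.
by rewrite twist_opp_lambda mul0rz subr0; exact: (@gop1x _ M).
Qed.
End Uniqueness.

Section RationalSubgroup.
Variables (X : set rat) (hX : subgroup rat_group X).
Local Open Scope ring_scope.

Lemma rat_subgroup_comm : commutative (gop (subg hX)).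
Proof. by apply: subg_commutative => p q _ _; exact: addrC. Qed.
Local Notation Z := (zmod_of rat_subgroup_comm).

Let val_mulz (p : Z) (i : int) : (val (p *~ i : X) : rat) = (val (p : X) : rat) *~ i.
Proof. exact: (@partial_morph_mulrz Z rat (fun _ => True) (fun p : X => val p)). Qed.

Lemma rat_subgroup_torsion_free : torsion_free (subg hX).
Proof.
apply: subg_torsion_free => p n n0.
have -> : gpow rat_group p n = p *+ n by elim: n {n0} => // n; rewrite mulrS => <-.
by move/eqP; rewrite mulrn_eq0 eqn0Ngt n0 => /eqP.
Qed.

(** Over a common denominator, Bezout's identity exhibits the gcd of the
    numerators as a combination of the two elements. *)
Lemma rat_subgroup_pair_cyclic : pair_cyclic Z.
Proof.
move=> p q; pose p' : rat := val (p : X); pose q' : rat := val (q : X).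
pose a := numq p' * denq q'; pose b := numq q' * denq p'.
pose dd := denq p' * denq q'; pose g := gcdz a b.
have dd0 : (dd%:~R : rat) != 0 by rewrite intr_eq0 mulf_neq0 ?denq_neq0.
have pE : p' * dd%:~R = a%:~R by rewrite /dd /a !rmorphM /= mulrA -numqE.
have qE : q' * dd%:~R = b%:~R by rewrite /dd /b !rmorphM /= mulrCA -numqE mulrC.
have [u [v uv]] := Bezoutz a b.
pose h : Z := p *~ u + q *~ v.
have hE : (val (h : X) : rat) * dd%:~R = g%:~R.
  rewrite - [val _]/(val (p *~ u : X) + val (q *~ v : X)) !val_mulz -/p' -/q'.
  by rewrite mulrDl -(mulrzl p') -(mulrzl q') -!mulrA pE qE /g -uv rmorphD !rmorphM.
exists h, (a %/ g)%Z, (b %/ g)%Z; split; apply: val_inj.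
- apply: (mulIf dd0); rewrite -/p' pE val_mulz -(mulrzl (val (h : X))) -mulrA hE -rmorphM /=.
  by rewrite divzK // dvdz_gcdl.
- apply: (mulIf dd0); rewrite -/q' qE val_mulz -(mulrzl (val (h : X))) -mulrA hE -rmorphM /=.
  by rewrite divzK // dvdz_gcdr.
Qed.
End RationalSubgroup.

Theorem theorem4p11 :
  (forall (T : Type) (B : skewBrace T),
     ~ trivial_brace B ->
     torsion_free (mulg B) -> locally_cyclic (mulg B) ->
     exists (C : set T) (hC : sub_skew_brace B C) (a : T),
       [/\ semidirect (addg B) C (generated (addg B) [set a]),
           trivial_brace (sub_brace hC) /\
             isomorphic (addg (sub_brace hC)) (mulg B),
           has_order (addg B) a 2 /\
             (forall c, C c -> a +[B] c +[B] -[B] a = -[B] c),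
           ~ dedekind B /\ ~ two_divisible (addg (sub_brace hC)) &
           [/\ ker_lambda B = C,
               forall b, C b -> lambda B a b = -[B] b &
               lambda B a a = a +[B] (a o[B] a)]
           \/
           [/\ ker_lambda B = [set 0[B]],
               star_set B setT C = [set 0[B]] &
               forall b, C b -> a o[B] b = a +[B] b]])
  /\
  (forall (X : set rat) (hX : subgroup rat_group X),
     let M := subg hX in
     ~ two_divisible M ->
     forall x : X, x <> gid M -> ~ squares M x ->
     exists A1 A2 : group X,
       unique (rules1 M x) A1 /\ unique (rules2 M x) A2 /\
       exists (h1 : brace_law A1 M) (h2 : brace_law A2 M),
         [/\ ker_lambda (SkewBrace h1) = squares M,
             ker_lambda (SkewBrace h2) = [set gid M] &
             SkewBrace h2 = opp_brace (SkewBrace h1)]).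
Proof.
split; first exact: skew_brace_structure.
move=> X hX M _ x _ nx.
have cyc := @rat_subgroup_pair_cyclic X hX; have tf := @rat_subgroup_torsion_free X hX.
exists (sign_twist cyc), (oppg (sign_twist cyc)); split; first exact: rules1_unique.
split; first exact: rules2_unique.
pose h1 := twist_brace (square_sign_sqr (mulC := rat_subgroup_comm hX)) (square_signM cyc).
exists h1, (oppg_brace_law (SkewBrace h1)); split=> //.
- exact: (sign_twist_ker cyc nx tf).
- exact: (sign_twist_opp_ker cyc nx tf).
Qed.
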